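(* Let $(X_n)$ be a sequence of Banach spaces all having $\mathrm{GL}_2$ so that $K=\sup_n \mathrm{gl}_2(X_n)<\infty$. Then $X=\left(\sum_{n=1}^\infty X_n\right)_2$ has $\mathrm{GL}_2$.
   Context: $\pi_1$ denotes the 1-summing norm. An operator $T:Z\to Y$ between Banach spaces factors through $L_1$ if $T=BA$ with $A: Z\to L_1(\nu)$, $B:L_1(\nu)\to Y$ bounded for some measure $\nu$, and $\gamma_1(T)=\inf\|A\|\|B\|$ over all such factorizations. A Banach space $Z$ has $\mathrm{GL}_2$ if every 1-summing operator from $Z$ to $\ell_2$ factors through $L_1$; equivalently, there is a constant $K$ with $\gamma_1(T)\le K\pi_1(T)$ for all finite rank $T:Z\to\ell_2$. The smallest such $K$ is denoted $\mathrm{gl}_2(Z)$. $\left(\sum_{n=1}^\infty X_n\right)_2$ is the $\ell_2$-sum: sequences $(x_n)$ with $x_n\in X_n$ and norm $(\sum\|x_n\|^2)^{1/2}<\infty$. *)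

(* Defs.v *)
From HB Require Import structures.
From mathcomp Require Import all_boot all_order all_algebra.
From mathcomp Require Import all_classical all_reals all_analysis.
From mathcomp Require Import measurable_realfun.
Set Implicit Arguments.
Unset Strict Implicit.
Unset Printing Implicit Defensive.
Import Order.TTheory GRing.Theory Num.Theory.
Import numFieldNormedType.Exports.
Local Open Scope classical_set_scope.
Local Open Scope ring_scope.

(* L_1(nu) for an arbitrary (possibly non-sigma-finite) measure nu.
   [LspaceType1 nu], the type of a.e.-classes of integrable functions, comes
   without algebraic structure: it is made here into a normed space. *)
Definition L1 d (T : measurableType d) (R : realType)
    (nu : {measure set T -> \bar R}) : Type := LspaceType1 nu.

Section L1_normed.
Context d (T : measurableType d) (R : realType).
Variable nu : {measure set T -> \bar R}.

Local Notation Lf := (LfunType nu (@lexx _ _ 1%E)).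

Definition L1_sort (f : L1 nu) : {mfun_ nu, T >-> measurableTypeR R} :=
  LebesgueSpace.sort f.
Coercion L1_fun (f : L1 nu) : T -> R := L1_sort f.

Lemma L1_sort_inj : injective L1_sort.
Proof.
move=> [f [[hf]]] [g [[hg]]]; rewrite /L1_sort/= => fg; subst g.
by rewrite (Prop_irrelevance hf hg).
Qed.

Lemma L1_funM (f : L1 nu) : measurable_fun setT f.
Proof. exact: (@measurable_funPT _ _ _ _ (repr (L1_sort f))). Qed.

Lemma L1_finite (f : L1 nu) : finite_norm nu 1 f.
Proof. by case: f => [f [[hf]]]. Qed.

Lemma L1_Lfun (f : L1 nu) : (f : T -> R) \in Lfun nu 1.
Proof.
by apply/andP; split; rewrite inE/=; [exact: L1_funM|exact: L1_finite].
Qed.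

Definition L1_rep (f : L1 nu) : Lf := Lfun_Sub (@lexx _ _ 1%E) (L1_Lfun f).

Definition mfun_of (f : Lf) : {mfun T >-> measurableTypeR R} :=
  HB.pack_for {mfun T >-> measurableTypeR R} (f : T -> measurableTypeR R)
    (@isMeasurableFun.Build _ _ T (measurableTypeR R) f
       (@measurable_funPT _ _ _ _ f)).

Definition L1_quot (f : Lf) : {mfun_ nu, T >-> measurableTypeR R} :=
  \pi_({mfun_ nu, T >-> measurableTypeR R})%qT (mfun_of f).

Lemma L1_quotE (f : Lf) : \forall x \ae nu, (L1_quot f : T -> R) x = f x.
Proof.
have /eqP := reprK (L1_quot f).
rewrite {2}/L1_quot eqmodE => /asboolP; apply: filterS => x.
by move=> /(_ I).
Qed.

Lemma eq_ae_Lnorm1 (f g : T -> R) : measurable_fun setT f -> measurable_fun setT g ->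
  (\forall x \ae nu, f x = g x) ->
  'N[nu]_1[EFin \o f]%E = 'N[nu]_1[EFin \o g]%E.
Proof.
move=> mf mg fg; rewrite !Lnorm1; apply: ae_eq_integral => //.
- by apply: measurableT_comp => //; exact/measurable_EFinP.
- by apply: measurableT_comp => //; exact/measurable_EFinP.
- by apply: filterS fg => x /= ->.
Qed.

Lemma L1_quot_finite (f : Lf) : finite_norm nu 1 (L1_quot f).
Proof.
rewrite /finite_norm (eq_ae_Lnorm1 _ _ (L1_quotE f)).
- exact: (@Lfunction_finite _ _ _ _ _ _ f).
- exact: (@measurable_funPT _ _ _ _ (repr (L1_quot f))).
- exact: (@measurable_funPT _ _ _ _ f).
Qed.

Definition L1_class (f : Lf) : L1 nu :=
  @LebesgueSpace.Pack d T R nu 1%E (@lexx _ _ 1%E) (L1_quot f)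
    (LebesgueSpace.Class
      (@isFinLebesgue.Build d T R nu 1%E (@lexx _ _ 1%E) _ (L1_quot_finite f))).

Lemma L1_classE (f : Lf) : \forall x \ae nu, L1_class f x = f x.
Proof. exact: L1_quotE. Qed.

Lemma L1_eqP (f g : L1 nu) : f = g <-> \forall x \ae nu, f x = g x.
Proof.
split=> [->|fg]; first exact: aeW.
apply: L1_sort_inj; rewrite -[LHS]reprK -[RHS]reprK; apply/eqP.
by rewrite eqmodE; apply/asboolP; apply: filterS fg.
Qed.

HB.instance Definition _ := gen_eqMixin (L1 nu).
HB.instance Definition _ := gen_choiceMixin (L1 nu).

Definition L1_zero : L1 nu := L1_class 0.
Definition L1_opp (f : L1 nu) : L1 nu := L1_class (- L1_rep f).
Definition L1_add (f g : L1 nu) : L1 nu := L1_class (L1_rep f + L1_rep g).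
Definition L1_scale (a : R) (f : L1 nu) : L1 nu := L1_class (a *: L1_rep f).

Lemma L1_zeroE : \forall x \ae nu, L1_zero x = 0.
Proof. exact: L1_classE. Qed.
Lemma L1_oppE f : \forall x \ae nu, L1_opp f x = - f x.
Proof. exact: L1_classE. Qed.
Lemma L1_addE f g : \forall x \ae nu, L1_add f g x = f x + g x.
Proof. exact: L1_classE. Qed.
Lemma L1_scaleE a f : \forall x \ae nu, L1_scale a f x = a * f x.
Proof. exact: L1_classE. Qed.

Lemma L1_addA : associative L1_add.
Proof.
move=> f g h; apply/L1_eqP.
have Hl : \forall x \ae nu, L1_add f (L1_add g h) x = f x + (g x + h x).
  by apply: filterS2 (L1_addE f (L1_add g h)) (L1_addE g h) => x -> ->.
have Hr : \forall x \ae nu, L1_add (L1_add f g) h x = f x + g x + h x.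
  by apply: filterS2 (L1_addE (L1_add f g) h) (L1_addE f g) => x -> ->.
by apply: filterS2 Hl Hr => x -> ->; rewrite addrA.
Qed.

Lemma L1_addC : commutative L1_add.
Proof.
move=> f g; apply/L1_eqP.
by apply: filterS2 (L1_addE f g) (L1_addE g f) => x -> ->; rewrite addrC.
Qed.

Lemma L1_add0 : left_id L1_zero L1_add.
Proof.
move=> f; apply/L1_eqP.
by apply: filterS2 (L1_addE L1_zero f) L1_zeroE => x -> ->; rewrite add0r.
Qed.

Lemma L1_addN : left_inverse L1_zero L1_opp L1_add.
Proof.
move=> f; apply/L1_eqP.
apply: filterS3 (L1_addE (L1_opp f) f) (L1_oppE f) L1_zeroE => x -> -> ->.
by rewrite addNr.
Qed.

HB.instance Definition _ :=
  GRing.isZmodule.Build (L1 nu) L1_addA L1_addC L1_add0 L1_addN.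

Lemma L1_scaleA a b f : L1_scale a (L1_scale b f) = L1_scale (a * b) f.
Proof.
apply/L1_eqP; apply: filterS3 (L1_scaleE a (L1_scale b f)) (L1_scaleE b f)
  (L1_scaleE (a * b) f) => x -> -> ->.
by rewrite mulrA.
Qed.

Lemma L1_scale1 : left_id 1 L1_scale.
Proof.
move=> f; apply/L1_eqP.
by apply: filterS (L1_scaleE 1 f) => x ->; rewrite mul1r.
Qed.

Lemma L1_scaleDr : right_distributive L1_scale +%R.
Proof.
move=> a f g; apply/L1_eqP.
have Hl : \forall x \ae nu, L1_scale a (f + g) x = a * (f x + g x).
  by apply: filterS2 (L1_scaleE a (f + g)) (L1_addE f g) => x -> ->.
apply: filterS2 Hl (filterI (L1_addE (L1_scale a f) (L1_scale a g))
  (filterI (L1_scaleE a f) (L1_scaleE a g))) => x -> [-> [-> ->]].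
by rewrite mulrDr.
Qed.

Lemma L1_scaleDl f : {morph L1_scale^~ f : a b / a + b}.
Proof.
move=> a b; apply/L1_eqP.
apply: filterS2 (L1_scaleE (a + b) f)
  (filterI (L1_addE (L1_scale a f) (L1_scale b f))
  (filterI (L1_scaleE a f) (L1_scaleE b f))) => x -> [-> [-> ->]].
by rewrite mulrDl.
Qed.

HB.instance Definition _ := GRing.Zmodule_isLmodule.Build R (L1 nu)
  L1_scaleA L1_scale1 L1_scaleDr L1_scaleDl.

Definition L1_norm (f : L1 nu) : R := fine ('N[nu]_1[EFin \o f])%E.

Lemma L1_normE (f : L1 nu) : (L1_norm f)%:E = 'N[nu]_1[EFin \o f]%E.
Proof. exact: (finite_norm_fine (L1_rep f)). Qed.

Lemma L1_class_norm (f : Lf) : L1_norm (L1_class f) = fine ('N[nu]_1[EFin \o f])%E.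
Proof.
congr fine; apply: eq_ae_Lnorm1.
- exact: L1_funM.
- exact: (@measurable_funPT _ _ _ _ f).
- exact: L1_classE.
Qed.

Lemma ler_L1_normD (f g : L1 nu) : L1_norm (f + g) <= L1_norm f + L1_norm g.
Proof. by rewrite L1_class_norm; exact: (ler_LnormD (L1_rep f) (L1_rep g)). Qed.

Lemma L1_normZ (a : R) (f : L1 nu) : L1_norm (a *: f) = `|a| * L1_norm f.
Proof.
apply: EFin_inj; rewrite EFinM !L1_normE; rewrite -[RHS](LnormZ (L1_rep f) a).
apply: eq_ae_Lnorm1; [exact: L1_funM| |exact: L1_scaleE].
exact: (@measurable_funPT _ _ _ _ (a *: L1_rep f : Lf)).
Qed.

Lemma L1_norm_eq0 (f : L1 nu) : L1_norm f = 0 -> f = 0.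
Proof.
move=> /(@fine_Lnormr_eq0 _ _ _ _ _ _ (L1_rep f)) f0; apply/L1_eqP.
by apply: filterS2 f0 L1_zeroE => x /(_ I) E1 E2; rewrite [RHS]E2; exact: E1.
Qed.

HB.instance Definition _ := Lmodule_isNormed.Build R (L1 nu)
  ler_L1_normD L1_normZ L1_norm_eq0.

End L1_normed.
(* The l_2-sum of the X_n, with X_n indexed from n = 0. *)
Definition l2_sqsum (R : realType) (X : nat -> completeNormedModType R)
    (x : forall n, X n) : \bar R :=
  (\sum_(n <oo) (`|x n| ^+ 2)%:E)%E.

Record l2sum (R : realType) (X : nat -> completeNormedModType R) := L2Sum {
  l2sum_seq :> forall n, X n;
  l2sumP : (l2_sqsum l2sum_seq < +oo)%E
}.

Section l2sum_banach.
Variables (R : realType) (X : nat -> completeNormedModType R).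
Implicit Types (x y z : l2sum X) (a b : R).

Lemma l2sum_eqP x y : (forall n, x n = y n) -> x = y.
Proof.
case: x y => [x hx] [y hy] /= xy.
have {}xy : x = y by apply: functional_extensionality_dep.
by subst y; rewrite (Prop_irrelevance hx hy).
Qed.

HB.instance Definition _ := gen_eqMixin (l2sum X).
HB.instance Definition _ := gen_choiceMixin (l2sum X).

Lemma l2_sqsum_ge0 (u : forall n, X n) : (0 <= l2_sqsum u)%E.
Proof. by apply: nneseries_ge0 => n _ _; rewrite lee_fin exprn_ge0. Qed.

Lemma l2_sqsum_Lnorm (u : nat -> R) : 'N[counting]_2%:E[EFin \o u]%E =
  ((\sum_(n <oo) (`|u n| ^+ 2)%:E) `^ 2^-1)%E.
Proof.
rewrite Lnorm_counting//; congr (_ `^ _)%E; apply: eq_eseriesr => n _.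
by rewrite /= powR_mulrn.
Qed.

Definition l2_norm (u : forall n, X n) : R := Num.sqrt (fine (l2_sqsum u)).

Lemma l2_normE (u : forall n, X n) : (l2_sqsum u < +oo)%E ->
  (l2_norm u)%:E = 'N[counting]_2%:E[EFin \o (fun n => `|u n|%R)]%E.
Proof.
move=> uoo; rewrite l2_sqsum_Lnorm.
under eq_eseriesr do rewrite normr_id.
rewrite -/(l2_sqsum u) /l2_norm -powR12_sqrt ?fine_ge0 ?l2_sqsum_ge0//.
by rewrite -poweR_EFin fineK// ge0_fin_numE// l2_sqsum_ge0.
Qed.

Lemma l2_sqsum_lty (u : forall n, X n) :
  (l2_sqsum u < +oo)%E <->
  ('N[counting]_2%:E[EFin \o (fun n => `|u n|%R)]%E < +oo)%E.
Proof.
split=> [uoo|]; first by rewrite -l2_normE// ltry.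
rewrite l2_sqsum_Lnorm; under eq_eseriesr do rewrite normr_id.
exact: lty_poweRy.
Qed.

Lemma measurable_nat_fun (u : nat -> R) : measurable_fun setT u.
Proof. by []. Qed.

Lemma l2_Lnorm_triangle (u v w : forall n, X n) :
  (forall n, `|w n| <= `|u n| + `|v n|) ->
  ('N[counting]_2%:E[EFin \o (fun n => `|w n|%R)] <=
   'N[counting]_2%:E[EFin \o (fun n => `|u n|%R)] +
   'N[counting]_2%:E[EFin \o (fun n => `|v n|%R)])%E.
Proof.
move=> wuv; have := @eminkowski _ nat R counting (fun n => `|u n|)
  (fun n => `|v n|) 2%:E (@measurable_nat_fun _) (@measurable_nat_fun _) (lee1n 2).
apply: le_trans; rewrite !l2_sqsum_Lnorm.
rewrite gt0_ler_poweR ?in_itv/= ?leey ?andbT//.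
- by apply: nneseries_ge0 => n _ _; rewrite lee_fin exprn_ge0.
- by apply: nneseries_ge0 => n _ _; rewrite lee_fin exprn_ge0.
- apply: lee_nneseries => n _; first by rewrite lee_fin exprn_ge0.
  by rewrite lee_fin lerXn2r ?nnegrE// normr_id (le_trans (wuv n))// ler_norm.
Qed.

Lemma l2_sqsumD (u v w : forall n, X n) :
  (forall n, `|w n| <= `|u n| + `|v n|) ->
  (l2_sqsum u < +oo -> l2_sqsum v < +oo -> l2_sqsum w < +oo)%E.
Proof.
move=> /l2_Lnorm_triangle h; rewrite !l2_sqsum_lty => u2 v2.
by rewrite (le_lt_trans h)// lte_add_pinfty.
Qed.

Lemma l2_normD (u v w : forall n, X n) :
  (forall n, `|w n| <= `|u n| + `|v n|) ->
  (l2_sqsum u < +oo)%E -> (l2_sqsum v < +oo)%E ->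
  l2_norm w <= l2_norm u + l2_norm v.
Proof.
move=> wuv u2 v2; have w2 := l2_sqsumD wuv u2 v2.
by rewrite -lee_fin EFinD !l2_normE//; exact: l2_Lnorm_triangle.
Qed.

Lemma l2_sqsumZ (u v : forall n, X n) a :
  (forall n, `|v n| = `|a| * `|u n|) ->
  l2_sqsum v = ((a ^+ 2)%:E * l2_sqsum u)%E.
Proof.
move=> vu; rewrite /l2_sqsum -nneseriesZl; last first.
  by move=> n _; rewrite lee_fin exprn_ge0.
by apply: eq_eseriesr => n _; rewrite vu exprMn real_normK ?num_real.
Qed.

Lemma l2_sqsumZ_lty (u v : forall n, X n) a :
  (forall n, `|v n| = `|a| * `|u n|) ->
  (l2_sqsum u < +oo -> l2_sqsum v < +oo)%E.
Proof.
move=> vu u2; rewrite (l2_sqsumZ vu) lte_mul_pinfty// lee_fin.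
exact: sqr_ge0.
Qed.

Lemma l2sum_zero_proof : (l2_sqsum (fun n => 0%R : X n) < +oo)%E.
Proof.
rewrite /l2_sqsum eseries0 ?ltry// => n _ _.
by rewrite normr0 expr0n.
Qed.

Lemma l2sum_opp_proof x : (l2_sqsum (fun n => (- x n)%R) < +oo)%E.
Proof.
apply: (@l2_sqsumZ_lty x _ 1) (l2sumP x) => n.
by rewrite normrN normr1 mul1r.
Qed.

Lemma l2sum_add_proof x y : (l2_sqsum (fun n => (x n + y n)%R) < +oo)%E.
Proof.
by apply: (@l2_sqsumD x y) (l2sumP x) (l2sumP y) => n; exact: ler_normD.
Qed.

Lemma l2sum_scale_proof a x : (l2_sqsum (fun n => (a *: x n)%R) < +oo)%E.
Proof.
by apply: (@l2_sqsumZ_lty x _ a) (l2sumP x) => n; rewrite normrZ.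
Qed.

Definition l2sum_zero : l2sum X := L2Sum l2sum_zero_proof.
Definition l2sum_opp x : l2sum X := L2Sum (l2sum_opp_proof x).
Definition l2sum_add x y : l2sum X := L2Sum (l2sum_add_proof x y).
Definition l2sum_scale a x : l2sum X := L2Sum (l2sum_scale_proof a x).

Lemma l2sum_addA : associative l2sum_add.
Proof. by move=> x y z; apply: l2sum_eqP => n /=; rewrite addrA. Qed.
Lemma l2sum_addC : commutative l2sum_add.
Proof. by move=> x y; apply: l2sum_eqP => n /=; rewrite addrC. Qed.
Lemma l2sum_add0 : left_id l2sum_zero l2sum_add.
Proof. by move=> x; apply: l2sum_eqP => n /=; rewrite add0r. Qed.
Lemma l2sum_addN : left_inverse l2sum_zero l2sum_opp l2sum_add.
Proof. by move=> x; apply: l2sum_eqP => n /=; rewrite addNr. Qed.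

HB.instance Definition _ := GRing.isZmodule.Build (l2sum X)
  l2sum_addA l2sum_addC l2sum_add0 l2sum_addN.

Lemma l2sum_scaleA a b x :
  l2sum_scale a (l2sum_scale b x) = l2sum_scale (a * b) x.
Proof. by apply: l2sum_eqP => n /=; rewrite scalerA. Qed.
Lemma l2sum_scale1 : left_id 1 l2sum_scale.
Proof. by move=> x; apply: l2sum_eqP => n /=; rewrite scale1r. Qed.
Lemma l2sum_scaleDr : right_distributive l2sum_scale +%R.
Proof. by move=> a x y; apply: l2sum_eqP => n /=; rewrite scalerDr. Qed.
Lemma l2sum_scaleDl x : {morph l2sum_scale^~ x : a b / a + b}.
Proof. by move=> a b; apply: l2sum_eqP => n /=; rewrite scalerDl. Qed.

HB.instance Definition _ := GRing.Zmodule_isLmodule.Build R (l2sum X)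
  l2sum_scaleA l2sum_scale1 l2sum_scaleDr l2sum_scaleDl.

Lemma l2sum_normD x y : l2_norm (x + y) <= l2_norm x + l2_norm y.
Proof.
by apply: l2_normD (l2sumP x) (l2sumP y) => n; exact: ler_normD.
Qed.

Lemma l2sum_normZ a x : l2_norm (a *: x) = `|a| * l2_norm x.
Proof.
rewrite /l2_norm (@l2_sqsumZ x _ a); last by move=> n; rewrite normrZ.
rewrite fineM//; last by rewrite ge0_fin_numE ?l2_sqsum_ge0 ?l2sumP.
by rewrite sqrtrM ?sqr_ge0// sqrtr_sqr.
Qed.

Lemma l2sum_coord_le x n : `|x n| <= l2_norm x.
Proof.
rewrite -[leLHS]ger0_norm// -sqrtr_sqr ler_wsqrtr// -lee_fin fineK; last first.
  by rewrite ge0_fin_numE ?l2_sqsum_ge0 ?l2sumP.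
have h k : (0 <= k)%N -> true -> (0 <= (`|x k| ^+ 2)%:E)%E.
  by move=> _ _; rewrite lee_fin exprn_ge0.
apply: le_trans (nneseries_lim_ge n.+1 h).
rewrite big_nat_recr//= leeDr// sume_ge0// => k _.
Qed.

Lemma l2sum_norm_eq0 x : l2_norm x = 0 -> x = 0.
Proof.
move=> x0; apply: l2sum_eqP => n; apply/eqP; rewrite -normr_eq0 eq_le normr_ge0.
by rewrite andbT -x0 l2sum_coord_le.
Qed.

HB.instance Definition _ := Lmodule_isNormed.Build R (l2sum X)
  l2sum_normD l2sum_normZ l2sum_norm_eq0.

Lemma l2sum_normE x : `|x| = Num.sqrt (fine (\sum_(n <oo) (`|x n| ^+ 2)%:E)%E).
Proof. by []. Qed.

Lemma l2_sqsum_le (u : forall n, X n) (c : R) : 0 <= c ->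
  (forall N, \sum_(0 <= n < N) `|u n| ^+ 2 <= c ^+ 2) ->
  (l2_sqsum u <= (c ^+ 2)%:E)%E.
Proof.
move=> c0 h; apply: lime_le.
  by apply: is_cvg_nneseries => n _ _; rewrite lee_fin exprn_ge0.
by apply: nearW => N; rewrite sumEFin lee_fin.
Qed.

Lemma l2sum_partial_le x N : \sum_(0 <= n < N) `|x n| ^+ 2 <= `|x| ^+ 2.
Proof.
rewrite sqr_sqrtr ?fine_ge0 ?l2_sqsum_ge0// -lee_fin fineK; last first.
  by rewrite ge0_fin_numE ?l2_sqsum_ge0 ?l2sumP.
rewrite -sumEFin; apply: nneseries_lim_ge => n _ _.
by rewrite lee_fin exprn_ge0.
Qed.

Lemma l2sum_complete (F : set_system (l2sum X)) :
  ProperFilter F -> cauchy F -> cvg F.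
Proof.
move=> FF /cauchyP Fc; apply/cvg_ex.
have Fcn n : cvg ((fun x : l2sum X => x n) @ F).
  apply: cauchy_cvg; apply/cauchyP => e e0.
  have [x Fx] := Fc e e0; exists (x n).
  have xn : ball x e `<=` (fun y : l2sum X => y n) @^-1` (ball (x n) e).
    move=> y; rewrite /preimage/= -!ball_normE /= => xy.
    exact: (le_lt_trans (l2sum_coord_le (x - y) n) xy).
  exact: filterS xn Fx.
pose u n : X n := lim ((fun x : l2sum X => x n) @ F).
have uP n : (fun x : l2sum X => x n) @ F --> u n by exact: Fcn.
have key (e : R) : 0 < e -> \forall x \near F,
    forall N, \sum_(0 <= n < N) `|(x : l2sum X) n - u n| ^+ 2 <= e ^+ 2.
  move=> e0; have [x0 Fx0] := Fc (e / 2) (divr_gt0 e0 (ltr0n _ 2)).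
  apply: filterS (Fx0) => x xx0 N.
  have cv : (\sum_(0 <= n < N) `|x n - (y : l2sum X) n| ^+ 2) @[y --> F] -->
      \sum_(0 <= n < N) `|x n - u n| ^+ 2.
    apply: cvg_big => [|n _]; first exact: add_continuous.
    have cn : `|x n - (y : l2sum X) n| @[y --> F] --> `|x n - u n|.
      by apply: cvg_norm; apply: cvgB; [exact: cvg_cst|exact: uP].
    exact: (cvgM cn cn).
  apply: (cvgr_to_le cv).
  apply: filterS Fx0 => y yx0; apply: le_trans (l2sum_partial_le (x - y) N) _.
  rewrite lerXn2r ?nnegrE// ?(ltW e0)// ltW//.
  move: xx0 yx0; rewrite -!ball_normE /= distrC => xx0 yx0.
  rewrite -(subrK x0 x) -addrA [ltRHS]splitr.
  by rewrite (le_lt_trans (ler_normD _ _))// ltrD.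
have [x1 x1P] := filter_ex (key 1 ltr01).
have u2 : (l2_sqsum u < +oo)%E.
  have h : (l2_sqsum (fun n => (x1 n - u n)%R) < +oo)%E.
    exact: le_lt_trans (l2_sqsum_le ler01 x1P) (ltry _).
  apply: (@l2_sqsumD x1 (fun n => x1 n - u n)) (l2sumP x1) h => n.
  by rewrite -[u n in leLHS](subKr (x1 n)) ler_normB.
exists (L2Sum u2); apply/cvgrPdist_le => e e0.
apply: filterS (key e e0) => x xe; rewrite distrC.
have := l2_sqsum_le (ltW e0) xe.
rewrite -[X in (X <= _)%E]fineK; last first.
  rewrite ge0_fin_numE ?l2_sqsum_ge0//.
  exact: (l2sumP (x - L2Sum u2)).
rewrite lee_fin => xe'.
rewrite -[leRHS](gtr0_norm e0) -sqrtr_sqr l2sum_normE.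
exact: (ler_wsqrtr xe').
Qed.

HB.instance Definition _ := Uniform_isComplete.Build (l2sum X) l2sum_complete.

End l2sum_banach.

Definition ell2 (R : realType) : completeNormedModType R :=
  l2sum (fun _ : nat => R^o : completeNormedModType R).

Section operators.
Variable R : realType.
Implicit Types Z Y : normedModType R.

Definition opnorm Z Y (T : Z -> Y) : \bar R :=
  ereal_sup [set `|T z|%:E | z in [set z : Z | `|z| <= 1]].

(* sup of \sum_i |f z_i| over the unit ball of the dual space, for a finite
   family (z_i) given as a sequence (repetitions allowed) *)
Definition weak_l1_norm Z (s : seq Z) : \bar R :=
  ereal_sup [set (\sum_(z <- s) `|f z|)%:E | f in
    [set f : {linear Z -> R^o} | continuous f /\ (opnorm f <= 1)%E]].

(* +oo when no constant C exists, i.e. when T is not 1-summing *)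
Definition pi1 Z Y (T : Z -> Y) : \bar R :=
  ereal_inf [set C%:E | C in [set C : R | 0 <= C /\
    forall s : seq Z, ((\sum_(z <- s) `|T z|)%:E <= C%:E * weak_l1_norm s)%E]].

Definition one_summing Z Y (T : {linear Z -> Y}) : Prop :=
  continuous T /\ (pi1 T < +oo)%E.

Definition L1_factorization Z Y (T : Z -> Y)
    (d : measure_display) (W : measurableType d) (nu : {measure set W -> \bar R})
    (A : {linear Z -> L1 nu}) (B : {linear L1 nu -> Y}) : Prop :=
  [/\ continuous A, continuous B & forall z, T z = B (A z)].

Definition factors_through_L1 Z Y (T : Z -> Y) : Prop :=
  exists (d : measure_display) (W : measurableType d)
    (nu : {measure set W -> \bar R})
    (A : {linear Z -> L1 nu}) (B : {linear L1 nu -> Y}), L1_factorization T A B.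

(* +oo when T does not factor through any L_1(nu) *)
Definition gamma1 Z Y (T : Z -> Y) : \bar R :=
  ereal_inf [set c | exists (d : measure_display) (W : measurableType d)
    (nu : {measure set W -> \bar R})
    (A : {linear Z -> L1 nu}) (B : {linear L1 nu -> Y}),
    L1_factorization T A B /\ c = (opnorm A * opnorm B)%E].

Definition finite_rank Z Y (T : Z -> Y) : Prop :=
  exists (n : nat) (e : 'I_n -> Y), forall z, exists c : 'I_n -> R,
    T z = \sum_i c i *: e i.

End operators.

Definition GL2 (R : realType) (Z : completeNormedModType R) : Prop :=
  forall T : {linear Z -> ell2 R}, one_summing T -> factors_through_L1 T.

(* The infimum is +oo if there is no admissible K, and otherwise it is attained
   since the inequality is closed in K. *)
Definition gl2 (R : realType) (Z : completeNormedModType R) : \bar R :=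
  ereal_inf [set K%:E | K in [set K : R | 0 <= K /\
    forall T : {linear Z -> ell2 R}, continuous T -> finite_rank T ->
      (gamma1 T <= K%:E * pi1 T)%E]].

(* Main.v *)
(** The restrictions T_n of a 1-summing operator T to the summands X_n satisfy
    sum_n |x_n| pi_1(T_n) <= pi_1(T) |x|. Hence it is enough to factor every T_n
    through l_1 with a norm O(K pi_1(T_n) + 2^-n): the l_1-sum of these
    factorizations is a factorization of T.

    As gl_2 only controls operators of finite rank, what is known is that
    gamma_1(P_m T_n) <= K pi_1(T_n) for the projection P_m on the first m
    coordinates. Averaging over finitely many cells of the measure space shows
    that, on finite sets of vectors z, P_m T_n z is close to a finite sum
    sum_r c_r(z) b_r with |b_r| <= 1 and sum_r |c_r(z)| <= C |z|. A limit along
    an ultrafilter of these discrete measures is a finitely additive measure on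
    the unit ball B of l_2, linear in z, of variation at most C |z| and with
    barycenter T_n z.

    The barycenter map is then lifted to l_1, in the manner of the theorem of
    Lewis and Stegall. For u in B and every k, stop the sequence of partial
    energies sum_(j < n) u_j^2 when it enters the interval of length 4^-k where
    it ends, and round the coordinates of u read so far. The results take
    countably many values and are within 2/2^k of u, so that u is a telescoping
    sum of countably-valued terms of norm at most 3/2^k, and T_n z is the sum of
    these values weighted by the measures of the sets where they are taken. *)
From HB Require Import structures.
Require Import Defs.
From mathcomp Require Import all_boot all_order all_algebra.
From mathcomp Require Import all_classical all_reals all_analysis.
From mathcomp Require Import measurable_realfun ring.
Set Implicit Arguments.
Unset Strict Implicit.
Unset Printing Implicit Defensive.
Import Order.TTheory GRing.Theory Num.Theory.
Import numFieldNormedType.Exports.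
Import HBSimple.
Local Open Scope classical_set_scope.
Local Open Scope ring_scope.

(** * Limits along ultrafilters *)

Definition bounded_by (R : realType) (I : Type) (M : R) (f : I -> R) : Prop :=
  forall i, `|f i| <= M.

(** [lim] is total, so this value is meaningful once convergence is known; for bounded functions and
    an ultrafilter [ulim_cvg] provides it. *)
Definition ulim (R : realType) (I : Type) (G : set_system I) (f : I -> R) : R :=
  lim (f @ G).

Section ultralimit.
Variables (R : realType) (I : Type) (G : set_system I).
Hypothesis UG : UltraFilter G.
Implicit Types (f g : I -> R) (M a : R).

Let PG : ProperFilter G := @ultra_proper _ _ UG.

Lemma fmap_ultra (U : Type) (h : I -> U) : UltraFilter (h @ G).
Proof.
split=> [|H PH sGH]; first exact: fmap_proper_filter.
apply/seteqP; split=> // A HA.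
have [//|GnA] := in_ultra_setVsetC (h @^-1` A) UG.
exfalso; apply: (@filter_not_empty _ H _); rewrite -(setICr A).
by apply: filterI => //; exact: sGH.
Qed.

(** The image of [G] is an ultrafilter containing the compact segment [-M, M], hence it
    converges. *)
Lemma ulim_cvg M f : bounded_by M f -> f @ G --> ulim G f.
Proof.
move=> fM; apply/cvg_ex.
have := @segment_compact R (- M) M; rewrite compact_ultra.
move=> /(_ (f @ G) (fmap_ultra f))[|p [_ fp]]; last by exists p.
by apply: (@filterE _ G) => i; rewrite /= in_itv/=; have := fM i; rewrite ler_norml.
Qed.

Lemma ulim_eq f l : f @ G --> l -> ulim G f = l.
Proof. by move=> fl; apply: cvg_lim. Qed.

Lemma ulim_cst a : ulim G (fun=> a) = a.
Proof. by apply: ulim_eq; exact: cvg_cst. Qed.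

Lemma ulimD M N f g : bounded_by M f -> bounded_by N g ->
  ulim G (fun i => f i + g i) = ulim G f + ulim G g.
Proof. by move=> /ulim_cvg fl /ulim_cvg gl; apply: ulim_eq; exact: cvgD. Qed.

Lemma ulimZ M a f : bounded_by M f ->
  ulim G (fun i => a * f i) = a * ulim G f.
Proof. by move=> /ulim_cvg fl; apply: ulim_eq; apply: cvgM => //; exact: cvg_cst. Qed.

Lemma ulim_le M N f g : bounded_by M f -> bounded_by N g ->
  (\forall i \near G, f i <= g i) -> ulim G f <= ulim G g.
Proof.
move=> /ulim_cvg fl /ulim_cvg gl fg.
have gfl : (fun i => g i - f i) @ G --> ulim G g - ulim G f by exact: cvgB.
rewrite -subr_ge0 -(cvg_lim (@Rhausdorff R) gfl).
apply: limr_ge; first by apply/cvg_ex; eexists; exact: gfl.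
by apply: filterS fg => i; rewrite /= subr_ge0.
Qed.

Lemma ulim_normr_le M N f g : bounded_by M f -> bounded_by N g ->
  (\forall i \near G, `|f i| <= g i) -> `|ulim G f| <= ulim G g.
Proof.
move=> bf bg fg; rewrite ler_norml; apply/andP; split; last first.
  by apply: ulim_le bf bg _; apply: filterS fg => i; exact/le_trans/ler_norm.
have bNg : bounded_by N (fun i => -1 * g i).
  by move=> i; rewrite mulN1r normrN; exact: bg.
rewrite -mulN1r -(ulimZ _ bg); apply: ulim_le bNg bf _.
by apply: filterS fg => i; rewrite mulN1r ler_norml => /andP[].
Qed.

Lemma bounded_ulim M f : bounded_by M f -> `|ulim G f| <= M.
Proof.
move=> bf; rewrite -(ulim_cst M).
apply: (@ulim_normr_le M `|M| f (fun=> M)) => //.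
by apply: nearW => i; exact: bf.
Qed.

Lemma ulim_sum (J : Type) (s : seq J) (x : J -> R) (F : J -> I -> R) (M : J -> R) :
  (forall j, bounded_by (M j) (F j)) ->
  ulim G (fun i => \sum_(j <- s) x j * F j i) = \sum_(j <- s) x j * ulim G (F j).
Proof.
move=> bF; elim: s => [|j s IH].
  by rewrite big_nil -[RHS]ulim_cst; congr ulim; apply/funext => i; rewrite big_nil.
rewrite big_cons -IH -(ulimZ _ (bF j)).
have b1 : bounded_by (`|x j| * M j) (fun i => x j * F j i).
  by move=> i; rewrite normrM ler_wpM2l// bF.
have b2 : bounded_by (\sum_(j <- s) `|x j| * M j) (fun i => \sum_(j <- s) x j * F j i).
  move=> i; apply: le_trans (ler_norm_sum _ _ _) _; apply: ler_sum => k _.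
  by rewrite normrM ler_wpM2l// bF.
by rewrite -(ulimD b1 b2); congr ulim; apply/funext => i; rewrite big_cons.
Qed.

End ultralimit.

(** * Bounded operators and l_2-sums *)

(** Any [N] with [u N] within [e] of the supremum works. It serves for the tails of a vector of the
    l_2-sum and for the integrals of the levels of codes. *)
Lemma nondecreasing_bounded_cauchy (R : realType) (u : nat -> R) (M e : R) :
  {homo u : m n / (m <= n)%N >-> m <= n} -> (forall n, u n <= M) -> 0 < e ->
  exists N, forall n, (N <= n)%N -> u n - u N <= e.
Proof.
move=> uh uM e0.
have hs : has_sup (range u).
  by split; [exists (u 0%N); exists 0%N|exists M => _ [n _ <-]].
have [_ [N _ <-] hN] := sup_adherent e0 hs.
exists N => n _; rewrite lerBlDl -lerBlDr ltW// (le_lt_trans _ hN)// lerB//.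
by apply: ub_le_sup; [case: hs|exists n].
Qed.

Definition linear_pack (R : pzRingType) (V W : lmodType R) (f : V -> W)
  (lf : linear f) : {linear V -> W} :=
  HB.pack_for {linear V -> W} f (GRing.isLinear.Build R V W *:%R f lf).

Lemma linear_bound (R : realType) (V W : normedModType R) (f : {linear V -> W}) :
  continuous f -> exists2 C : R, 0 <= C & forall z, `|f z| <= C * `|z|.
Proof.
move=> fc; have := linear_bounded_continuous f; case=> _ /(_ fc).
move=> /linear_boundedP/pinfty_ex_gt0[C C0 hC].
by exists C => //; exact: ltW.
Qed.

Lemma bound_linear_continuous (R : realType) (V W : normedModType R)
  (f : {linear V -> W}) (C : R) : (forall z, `|f z| <= C * `|z|) -> continuous f.
Proof.
move=> hC; apply/linear_bounded_continuous/linear_boundedP.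
apply: filterS (nbhs_pinfty_ge (num_real C)) => r Cr z.
by apply: le_trans (hC z) _; rewrite ler_wpM2r.
Qed.

Section opnorm_theory.
Variables (R : realType) (V W : normedModType R).
Implicit Types f : {linear V -> W}.

Lemma opnorm_ge0 f : (0 <= opnorm f)%E.
Proof.
by apply: ereal_sup_ubound; exists 0; rewrite /= ?normr0 ?linear0 ?normr0 ?ler01.
Qed.

Lemma opnorm_le f (C : R) : 0 <= C ->
  (forall z, `|f z| <= C * `|z|) -> (opnorm f <= C%:E)%E.
Proof.
move=> C0 h; apply: ge_ereal_sup => _ [z /= z1 <-].
by rewrite lee_fin (le_trans (h z))// ler_piMr.
Qed.

Lemma opnorm_fin_num f : continuous f -> opnorm f \is a fin_num.
Proof.
move=> /linear_bound[C C0 h]; rewrite ge0_fin_numE ?opnorm_ge0//.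
exact: le_lt_trans (opnorm_le C0 h) (ltry _).
Qed.

Lemma opnormP f z : continuous f -> `|f z| <= fine (opnorm f) * `|z|.
Proof.
move=> fc; have [->|z0] := eqVneq z 0; first by rewrite linear0 !normr0 mulr0.
rewrite -ler_pdivrMr ?normr_gt0// -lee_fin fineK ?opnorm_fin_num//.
apply: ereal_sup_ubound; exists (`|z|^-1 *: z) => /=.
  by rewrite normrZ normfV normr_id mulVf ?normr_eq0.
by rewrite linearZ normrZ normfV normr_id mulrC.
Qed.

End opnorm_theory.

Section l2sum_theory.
Variables (R : realType) (X : nat -> completeNormedModType R).
Implicit Types (x y : l2sum X).

Lemma l2sum_norm_le x (c : R) : 0 <= c ->
  (forall N, \sum_(0 <= n < N) `|x n| ^+ 2 <= c ^+ 2) -> `|x| <= c.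
Proof.
move=> c0 h; have := l2_sqsum_le c0 h.
rewrite -[X in (X <= _)%E]fineK; last by rewrite ge0_fin_numE ?l2_sqsum_ge0 ?l2sumP.
by rewrite lee_fin => /ler_wsqrtr; rewrite sqrtr_sqr (ger0_norm c0).
Qed.

Lemma l2sum_coord_sum (J : Type) (s : seq J) (F : J -> l2sum X) n :
  (\sum_(j <- s) F j) n = \sum_(j <- s) F j n.
Proof. by elim/big_rec2: _ => //= j y1 y2 _ <-. Qed.

(** The type of entry [k] depends on [k], so [z] has to be transported along a proof of [n = k]. *)
Definition inj_seq n (z : X n) (k : nat) : X k :=
  match pselect (n = k) with
  | left e => ecast k (X k : Type) e z
  | right _ => 0
  end.

Lemma inj_seq_id n (z : X n) : inj_seq z n = z.
Proof. by rewrite /inj_seq; case: pselect => // e; rewrite eq_axiomK. Qed.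

Lemma inj_seq_neq n (z : X n) k : n <> k -> inj_seq z k = 0.
Proof. by rewrite /inj_seq; case: pselect. Qed.

Lemma inj_seq_sum n (z : X n) N :
  \sum_(0 <= k < N) `|inj_seq z k| ^+ 2 = if (n < N)%N then `|z| ^+ 2 else 0.
Proof.
elim: N => [|N IH]; first by rewrite big_nil.
rewrite big_nat_recr//= IH ltnS [(n <= N)%N]leq_eqVlt.
have [<-|nN] := eqVneq n N; first by rewrite ltnn add0r inj_seq_id.
by rewrite inj_seq_neq ?normr0 ?expr0n ?addr0//=; exact/eqP.
Qed.

Lemma inj_seq_l2 n (z : X n) : (l2_sqsum (inj_seq z) < +oo)%E.
Proof.
apply: le_lt_trans (ltry (`|z| ^+ 2)); apply: l2_sqsum_le => // N.
by rewrite inj_seq_sum; case: ifP => // _; exact: exprn_ge0.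
Qed.

Definition l2sum_inj_fun n (z : X n) : l2sum X := L2Sum (inj_seq_l2 z).

Lemma l2sum_inj_linear n : linear (@l2sum_inj_fun n).
Proof.
move=> a z w; apply: l2sum_eqP => k /=.
have [<-|/eqP nk] := eqVneq n k; first by rewrite !inj_seq_id.
by rewrite !inj_seq_neq// scaler0 addr0.
Qed.

Definition l2sum_inj n : {linear X n -> l2sum X} :=
  linear_pack (@l2sum_inj_linear n).

Lemma l2sum_inj_norm n (z : X n) : `|l2sum_inj n z| <= `|z|.
Proof.
apply: l2sum_norm_le => // N; rewrite (inj_seq_sum z).
by case: ifP => // _; exact: exprn_ge0.
Qed.

Lemma l2sum_norm_le_coord x y : (forall n, `|x n| <= `|y n|) -> `|x| <= `|y|.
Proof.
move=> xy; apply: l2sum_norm_le => // N; apply: le_trans (l2sum_partial_le y N).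
by apply: ler_sum => n _; rewrite lerXn2r ?nnegrE.
Qed.

(** Written as a finite sum of injections, so that linear maps can be pushed through it. *)
Definition l2sum_cut N (u : forall n, X n) : l2sum X :=
  \sum_(0 <= n < N) l2sum_inj n (u n).

Lemma l2sum_cutE N (u : forall n, X n) k :
  l2sum_cut N u k = if (k < N)%N then u k else 0.
Proof.
rewrite l2sum_coord_sum; elim: N => [|N IH]; first by rewrite big_nil.
rewrite big_nat_recr//= IH ltnS [(k <= N)%N]leq_eqVlt.
have [->|kN] := eqVneq k N; first by rewrite ltnn add0r inj_seq_id.
by rewrite inj_seq_neq ?addr0//; apply/eqP; rewrite eq_sym.
Qed.

Lemma l2sum_cut_cvg x : l2sum_cut N x @[N --> \oo] --> x.
Proof.
apply/cvgrPdist_le => e e0.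
pose u N := \sum_(0 <= n < N) `|x n| ^+ 2.
have uh : {homo u : m n / (m <= n)%N >-> m <= n}.
  move=> m n mn; rewrite /u (big_cat_nat (leq0n m) mn)/= lerDl.
  by apply: sumr_ge0 => i _; exact: exprn_ge0.
have [N hN] := nondecreasing_bounded_cauchy uh (l2sum_partial_le x) (exprn_gt0 2 e0).
(* The remainder after [M >= N] coordinates has its energy between [N] and [maxn M n], where the
   partial sums of [|x n| ^+ 2] grow by at most [e ^+ 2]. *)
exists N => //= M NM; apply: l2sum_norm_le (ltW e0) _ => n.
apply: le_trans (hN _ (leq_trans NM (leq_maxl M n))).
rewrite lerBrDr.
have -> : u N = \sum_(0 <= i < maxn M n) if (i < N)%N then `|x i| ^+ 2 else 0.
  rewrite (big_cat_nat (leq0n N) (leq_trans NM (leq_maxl _ _)))/=.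
  have -> : \sum_(N <= i < maxn M n) (if (i < N)%N then `|x i| ^+ 2 else 0) = 0.
    by rewrite big_nat big1// => i /andP[Ni _]; rewrite ltnNge Ni.
  by rewrite addr0 /u !big_nat; apply: eq_bigr => i /andP[_ ->].
apply: (@le_trans _ _ (\sum_(0 <= i < maxn M n) `|(x - l2sum_cut M x) i| ^+ 2 +
   \sum_(0 <= i < maxn M n) if (i < N)%N then `|x i| ^+ 2 else 0)).
  rewrite lerD2r [leRHS](big_cat_nat (leq0n n) (leq_maxr _ _))/= lerDl.
  by apply: sumr_ge0 => i _; exact: exprn_ge0.
rewrite -big_split/=; apply: ler_sum => i _.
rewrite l2sum_cutE.
case: ifPn => iM; first by rewrite subrr normr0 expr0n add0r; case: ifP => // _; exact: exprn_ge0.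
case: ifPn => iN; last by rewrite subr0 addr0.
by rewrite (leq_trans iN NM) in iM.
Qed.

End l2sum_theory.

(** * Factorization through l_1 *)

Section L1_of_integrable.
Context d (W : measurableType d) (R : realType) (nu : {measure set W -> \bar R}).

Definition L1_of (f : W -> R) (fP : f \in Lfun nu 1) : L1 nu :=
  L1_class (Lfun_Sub (@lexx _ _ 1%E) fP).

Lemma L1_ofE (f : W -> R) (fP : f \in Lfun nu 1) :
  \forall x \ae nu, L1_of fP x = f x.
Proof. exact: L1_classE. Qed.

Lemma L1_normrE (f : L1 nu) : `|f|%:E = (\int[nu]_x `|f x|%:E)%E.
Proof. exact: (etrans (L1_normE f) (Lnorm1 _ _)). Qed.

End L1_of_integrable.

Section ell1.
Variable R : realType.

Definition nat_counting : {measure set nat -> \bar R} := @counting nat R.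

(** A set of counting measure zero is empty; thus classes modulo null sets are genuine sequences. *)
Lemma ae_counting (P : nat -> Prop) :
  (\forall x \ae nat_counting, P x) -> forall x, P x.
Proof.
case=> A [_ A0 PA] n; apply: contrapT => Pn.
have An : A n by exact: PA.
move: A0; rewrite /nat_counting/= /counting; case: asboolP => // fA [] /eqP.
rewrite pnatr_eq0 finmap.cardfs_eq0 => /eqP A0.
by move: An; rewrite -(fset_setK fA) A0 /= finmap.in_fset0.
Qed.

Lemma ell1_normE (f : L1 nat_counting) :
  `|f|%:E = (\sum_(i <oo) `|f i|%:E)%E.
Proof. by rewrite L1_normrE ge0_integral_count// => k; rewrite lee_fin. Qed.

Lemma ell1_partial_le (f : L1 nat_counting) N :
  \sum_(0 <= i < N) `|f i| <= `|f|.
Proof.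
rewrite -lee_fin ell1_normE -sumEFin; apply: nneseries_lim_ge => n _ _.
by rewrite lee_fin.
Qed.

Lemma nneseries_le_partial (f : nat -> R) (C : R) :
  (forall N, \sum_(0 <= i < N) `|f i| <= C) ->
  (\sum_(i <oo) `|f i|%:E <= C%:E)%E.
Proof.
move=> h; apply: lime_le; first exact: is_cvg_nneseries.
by apply: nearW => N; rewrite sumEFin lee_fin.
Qed.

Lemma ell1_mem (f : nat -> R) (C : R) :
  (forall N, \sum_(0 <= i < N) `|f i| <= C) -> f \in Lfun nat_counting 1.
Proof.
move=> h; rewrite inE; apply/andP; split; rewrite inE//=.
rewrite /finite_norm Lnorm1 ge0_integral_count//.
exact: le_lt_trans (nneseries_le_partial h) (ltry _).
Qed.

Lemma ell1_of_norm (f : nat -> R) (C : R) (fP : f \in Lfun nat_counting 1) :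
  (forall N, \sum_(0 <= i < N) `|f i| <= C) -> `|L1_of fP| <= C.
Proof.
move=> h; rewrite -lee_fin ell1_normE.
have /ae_counting fE := L1_ofE fP.
by under eq_eseriesr do rewrite fE; exact: nneseries_le_partial.
Qed.

Lemma ell1_addE (f g : L1 nat_counting) i : (f + g) i = f i + g i.
Proof. exact: (ae_counting (L1_addE f g)). Qed.

Lemma ell1_scaleE a (f : L1 nat_counting) i : (a *: f) i = a * f i.
Proof. exact: (ae_counting (L1_scaleE a f)). Qed.

Section to_ell1.
Variables (X : normedModType R) (a : nat -> X -> R) (C : R).
Hypothesis a_lin : forall i b x y, a i (b *: x + y) = b * a i x + a i y.
Hypothesis a_sum : forall x N, \sum_(0 <= i < N) `|a i x| <= C * `|x|.

Definition to_ell1_fun x := L1_of (ell1_mem (a_sum x)).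

Lemma to_ell1_funE x i : to_ell1_fun x i = a i x.
Proof. exact: (ae_counting (L1_ofE (ell1_mem (a_sum x)))). Qed.

Lemma to_ell1_linear : linear to_ell1_fun.
Proof.
move=> b x y; apply/L1_eqP/aeW => i.
by rewrite ell1_addE ell1_scaleE !to_ell1_funE.
Qed.

Definition to_ell1 : {linear X -> L1 nat_counting} := linear_pack to_ell1_linear.

Lemma to_ell1E x i : to_ell1 x i = a i x.
Proof. exact: to_ell1_funE. Qed.

Lemma to_ell1_continuous : continuous to_ell1.
Proof.
apply: (@bound_linear_continuous _ _ _ _ C) => x.
exact: (ell1_of_norm (ell1_mem (a_sum x)) (a_sum x)).
Qed.

End to_ell1.

Section from_ell1.
Variables (Y : completeNormedModType R) (d : nat -> Y).
Hypothesis d1 : forall i, `|d i| <= 1.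

Definition from_ell1_fun (f : L1 nat_counting) : Y :=
  limn (series (fun i => f i *: d i)).

Lemma from_ell1_fun_cvg (f : L1 nat_counting) :
  series (fun i => f i *: d i) @ \oo --> from_ell1_fun f.
Proof.
apply: normed_cvg; apply: nondecreasing_is_cvgn.
  by apply: nondecreasing_series => n *; exact: normr_ge0.
exists `|f| => _ [N _ <-]; apply: le_trans (ell1_partial_le f N).
by apply: ler_sum => i _; rewrite /= normrZ ler_piMr.
Qed.

Lemma from_ell1_linear : linear from_ell1_fun.
Proof.
move=> b f g; apply: cvg_lim => //.
have -> : series (fun i => (b *: f + g) i *: d i) = (fun N =>
    b *: series (fun i => f i *: d i) N + series (fun i => g i *: d i) N).
  apply/funext => N; rewrite /series/= scaler_sumr -big_split/=.
  by apply: eq_bigr => i _; rewrite ell1_addE ell1_scaleE scalerDl scalerA.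
by apply: cvgD; [apply: cvgZr|]; exact: from_ell1_fun_cvg.
Qed.

Definition from_ell1 : {linear L1 nat_counting -> Y} :=
  linear_pack from_ell1_linear.

Lemma from_ell1_cvg (f : L1 nat_counting) :
  series (fun i => f i *: d i) @ \oo --> from_ell1 f.
Proof. exact: from_ell1_fun_cvg. Qed.

Lemma from_ell1_continuous : continuous from_ell1.
Proof.
apply: (@bound_linear_continuous _ _ _ _ 1) => f; rewrite mul1r.
have cv : (fun N => `|series (fun i => f i *: d i) N|) @ \oo --> `|from_ell1 f|.
  by apply: cvg_norm; exact: from_ell1_cvg.
apply: (cvgr_to_le cv); apply: nearW => N /=.
apply: le_trans (ler_norm_sum _ _ _) _.
apply: le_trans (ell1_partial_le f N).
by apply: ler_sum => i _; rewrite /= normrZ ler_piMr.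
Qed.

End from_ell1.

End ell1.

Section family_factorization.
Variables (R : realType) (X : normedModType R) (J : countType).
Variables (a : J -> X -> R) (d : J -> ell2 R) (C : R).
Hypothesis a_lin : forall j b x y, a j (b *: x + y) = b * a j x + a j y.
Hypothesis a_sum : forall x (s : seq J), uniq s ->
  \sum_(j <- s) `|a j x| * `|d j| <= C * `|x|.

(** An exhaustion of [J] by finite lists without repetition; integers that code no element are
    skipped. *)
Let dec N : seq J := pmap pickle_inv (iota 0 N).

Let dec_uniq N : uniq (dec N).
Proof. by apply: (pmap_uniq (@pickle_invK J)); exact: iota_uniq. Qed.

Let sum_dec (V : nmodType) (F : J -> V) N :
  \sum_(0 <= i < N) oapp F 0 (pickle_inv i) = \sum_(j <- dec N) F j.
Proof. by rewrite /dec big_pmap/= /index_iota subn0. Qed.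

Let mem_dec (s : seq J) : exists N0, forall N, (N0 <= N)%N -> {subset s <= dec N}.
Proof.
exists (\sum_(j <- s) (pickle j).+1)%N => N hN j js.
rewrite mem_pmap; apply/mapP; exists (pickle j); last by rewrite pickleK_inv.
rewrite mem_iota add0n/=; apply: leq_trans hN.
by rewrite (big_rem j)//= leq_addr.
Qed.

(** The weight [|d j|] is moved from the vector to the coefficient, so that the vectors have norm at
    most 1. If [d j = 0], both become 0. *)
Let anat i x := oapp (fun j => `|d j| * a j x) 0 (pickle_inv i).
Let dnat i := oapp (fun j => `|d j|^-1 *: d j) 0 (@pickle_inv J i).

Let anat_lin i b x y : anat i (b *: x + y) = b * anat i x + anat i y.
Proof.
rewrite /anat; case: pickle_inv => [j|] /=; last by rewrite mulr0 addr0.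
by rewrite a_lin mulrDr mulrCA.
Qed.

Let anat_sum x N : \sum_(0 <= i < N) `|anat i x| <= C * `|x|.
Proof.
apply: le_trans (a_sum x (dec_uniq N)); rewrite -sum_dec.
apply: ler_sum => i _; rewrite /anat; case: pickle_inv => [j|] /=.
  by rewrite normrM normr_id mulrC.
by rewrite normr0.
Qed.

Let dnat1 i : `|dnat i| <= 1.
Proof.
rewrite /dnat; case: pickle_inv => [j|] /=; last by rewrite normr0.
rewrite normrZ normfV normr_id.
by have [->|dj0] := eqVneq `|d j| 0; rewrite ?mulr0// mulVf.
Qed.

(** [A] sends x to its weighted coefficients and [B] sums the series. The convergence criterion
    stands under the quantifier on [x], so that it can be checked for some vectors only.
    Coordinatewise convergence is enough: the series converges in norm, and its coordinates
    determine its sum. *)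
Lemma family_factorization : exists (A : {linear X -> L1 (nat_counting R)})
    (B : {linear L1 (nat_counting R) -> ell2 R}),
  [/\ continuous A, continuous B & forall x (y : ell2 R),
    (forall i e, 0 < e -> exists s0 : seq J, forall s, uniq s -> {subset s0 <= s} ->
      `|y i - \sum_(j <- s) a j x * d j i| <= e) -> B (A x) = y].
Proof.
exists (to_ell1 anat_lin anat_sum), (from_ell1 dnat1); split.
- exact: to_ell1_continuous.
- exact: from_ell1_continuous.
move=> x y hy; apply: l2sum_eqP => i.
set f := to_ell1 _ _ x.
have cvi : (fun N => (series (fun k => f k *: dnat k) N : ell2 R) i) @ \oo -->
    (from_ell1 dnat1 f : ell2 R) i.
  apply/cvgrPdist_le => e e0.
  have /cvgrPdist_le/(_ e e0) := @from_ell1_cvg _ _ _ dnat1 f.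
  apply: filterS => N; apply: le_trans.
  exact: (l2sum_coord_le (from_ell1 dnat1 f - series (fun k => f k *: dnat k) N) i).
have serE N : (series (fun k => f k *: dnat k) N : ell2 R) i =
    \sum_(j <- dec N) a j x * d j i.
  rewrite /series/= l2sum_coord_sum -sum_dec; apply: eq_bigr => k _.
  have -> : f k = anat k x by exact: to_ell1E.
  rewrite /anat /dnat; case: (pickle_inv k) => [j|]/=; last by rewrite scale0r.
  have [->|dj0] := eqVneq (d j) 0; first by rewrite scaler0 scaler0 [RHS]mulr0.
  change (`|d j| * a j x * (`|d j|^-1 * d j i) = a j x * d j i).
  by rewrite mulrACA divff ?mul1r// normr_eq0.
(* The lists [dec N] eventually contain any given finite set, so the unordered convergence to [y i]
   applies to the partial sums. *)
apply: (cvg_unique (@norm_hausdorff _ R^o) cvi).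
apply/cvgrPdist_le => e e0.
have [s0 hs0] := hy i e e0; have [N0 hN0] := mem_dec s0.
by exists N0 => //= N N0N; rewrite serE; apply: hs0 (dec_uniq N) (hN0 _ N0N).
Qed.

End family_factorization.

(** * Rounding in the unit ball of l_2 *)

Section ell2_truncation.
Variable R : realType.
Implicit Types (f g : nat -> R) (m n : nat).

Definition trunc_seq m f (i : nat) : R^o := if (i < m)%N then f i else 0.

Lemma trunc_seq_sum m f N : \sum_(0 <= i < N) `|trunc_seq m f i| ^+ 2 <=
  \sum_(0 <= i < m) f i ^+ 2.
Proof.
apply: (@le_trans _ _ (\sum_(0 <= i < maxn m N) `|trunc_seq m f i| ^+ 2)).
  rewrite [leRHS](big_cat_nat (leq0n N) (leq_maxr _ _))/= lerDl.
  by apply: sumr_ge0 => i _; exact: exprn_ge0.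
rewrite (big_cat_nat (leq0n m) (leq_maxl _ _))/=.
have -> : \sum_(m <= i < maxn m N) `|trunc_seq m f i| ^+ 2 = 0.
  rewrite big_nat big1// => i /andP[mi _].
  by rewrite /trunc_seq ltnNge mi normr0 expr0n.
rewrite addr0 !big_nat; apply: ler_sum => i /andP[_ im].
by rewrite /trunc_seq im real_normK ?num_real.
Qed.

Lemma trunc_seq_l2 m f : (l2_sqsum (trunc_seq m f) < +oo)%E.
Proof.
set c := \sum_(0 <= i < m) f i ^+ 2.
have c0 : 0 <= c by apply: sumr_ge0 => i _; exact: sqr_ge0.
apply: le_lt_trans (ltry (Num.sqrt c ^+ 2)).
apply: l2_sqsum_le => [|N]; first exact: sqrtr_ge0.
by rewrite sqr_sqrtr//; exact: trunc_seq_sum.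
Qed.

Definition ell2_trunc m f : ell2 R := L2Sum (trunc_seq_l2 m f).

Lemma ell2_truncE m f i : ell2_trunc m f i = if (i < m)%N then f i else 0.
Proof. by []. Qed.

Lemma ell2_trunc_norm m f (c : R) : 0 <= c ->
  \sum_(0 <= i < m) f i ^+ 2 <= c ^+ 2 -> `|ell2_trunc m f| <= c.
Proof.
by move=> c0 h; apply: l2sum_norm_le => // N; exact: le_trans (trunc_seq_sum m f N) h.
Qed.

End ell2_truncation.

Section codes.
Variables (R : realType) (U : Type) (crd : U -> nat -> R).
Hypothesis crd1 : forall u N, \sum_(0 <= j < N) crd u j ^+ 2 <= 1.
Implicit Types (k n l : nat) (u : U).

Definition energy n u : R := \sum_(0 <= j < n) crd u j ^+ 2.

(** The number of the interval of length 4^-k that contains the energy of the first [n]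
    coordinates. *)
Definition level k n u : nat := Num.trunc (4 ^+ k * energy n u).

Lemma energy_ge0 n u : 0 <= energy n u.
Proof. by apply: sumr_ge0 => i _; exact: sqr_ge0. Qed.

Lemma energyD m n u : (m <= n)%N ->
  energy n u = energy m u + \sum_(m <= j < n) crd u j ^+ 2.
Proof. by move=> mn; rewrite /energy (big_cat_nat (leq0n m) mn). Qed.

Lemma level_homo k m n u : (m <= n)%N -> (level k m u <= level k n u)%N.
Proof.
move=> mn; apply: le_truncn; rewrite ler_wpM2l ?exprn_ge0//.
by rewrite (energyD _ mn) lerDl sumr_ge0// => i _; exact: sqr_ge0.
Qed.

Lemma level_le k n u : (level k n u <= 4 ^ k)%N.
Proof.
rewrite -(natrK (R := R) (4 ^ k)) natrX; apply: le_truncn.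
by rewrite ler_piMr ?exprn_ge0//; exact: crd1.
Qed.

Lemma level_energy k m n u : level k m u = level k n u ->
  energy n u - energy m u <= 4 ^- k.
Proof.
move=> mn.
have p0 l : 0 <= 4 ^+ k * energy l u by rewrite mulr_ge0 ?exprn_ge0 ?energy_ge0.
have /andP[_ h1] := truncn_itv (p0 n); have /andP[h2 _] := truncn_itv (p0 m).
rewrite -(ler_pM2l (x := 4 ^+ k)) ?exprn_gt0// mulfV ?expf_neq0//.
rewrite mulrBr lerBlDr; apply: le_trans (ltW h1) _.
by rewrite -[X in X%:R <= _]add1n natrD lerD2l -[Num.trunc _]mn.
Qed.

(* The first l at which the energy reaches the level it has at n; it depends on
   n only through this level. *)
Definition stop k n u : nat :=
  ex_minn (ex_intro (fun l => level k l u == level k n u) n (eqxx _)).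

Lemma stop_le k n u : (stop k n u <= n)%N.
Proof. by rewrite /stop; case: ex_minnP => l _; exact. Qed.

Lemma stop_level k n u : level k (stop k n u) u = level k n u.
Proof. by rewrite /stop; case: ex_minnP => l /eqP. Qed.

Lemma stop_eq k m n u : level k m u = level k n u -> stop k m u = stop k n u.
Proof.
rewrite /stop => mn; case: ex_minnP => l /eqP hl ml; case: ex_minnP => l' /eqP hl' ml'.
by apply/eqP; rewrite eqn_leq ml ?ml' ?hl ?hl' ?mn.
Qed.

(* With k + l digits, the l rounding errors have a sum of squares <= 4 ^- k. *)
Definition code k n u : seq int :=
  mkseq (fun j => Num.floor (2 ^+ (k + stop k n u) * crd u j)) (stop k n u).

Lemma code_eq k m n u : level k m u = level k n u -> code k m u = code k n u.
Proof. by move=> /stop_eq mn; rewrite /code mn. Qed.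

(* A code of length l stands for a vector supported by the first l coordinates;
   the value 0 at k = 0 makes the telescoping sum start from 0. *)
Definition code_val k (s : seq int) : ell2 R :=
  if k is 0 then 0
  else ell2_trunc (size s) (fun j => (nth 0 s j)%:~R / 2 ^+ (k + size s)).

(** Two errors of norm at most 2^-k add up. The coordinates between the stop and [n] have energy at
    most 4^-k since the level is the same at both ends; the others are only rounded. For [k = 0] the
    value is 0 and the vector itself has norm at most 1. *)
Lemma code_close k n u :
  `|ell2_trunc n (crd u) - code_val k (code k n u)| <= 2 / 2 ^+ k.
Proof.
case: k => [|k].
  rewrite /= subr0 expr0 divr1; apply: (@le_trans _ _ 1); last by rewrite ler1n.
  by apply: ell2_trunc_norm => //; rewrite expr1n; exact: crd1.
rewrite [code_val _ _]/=; move: (k.+1) => {}k.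
have -> : 2 / 2 ^+ k = 2 ^- k + 2 ^- k :> R by rewrite mulr_natl mulr2n.
set l := stop k n u; have ln : (l <= n)%N := stop_le k n u.
rewrite -(subrK (ell2_trunc l (crd u)) (ell2_trunc n (crd u))) -addrA.
apply: le_trans (ler_normD _ _) _; apply: lerD.
  have -> : ell2_trunc n (crd u) - ell2_trunc l (crd u) =
      ell2_trunc n (fun j => if (j < l)%N then 0 else crd u j).
    apply: l2sum_eqP => i.
    change (trunc_seq n (crd u) i - trunc_seq l (crd u) i =
      trunc_seq n (fun j => if (j < l)%N then 0 else crd u j) i).
    rewrite /trunc_seq; case: ifPn => il; case: ifPn => il'//; rewrite ?subrr ?subr0//.
    by rewrite (leq_trans il' ln) in il.
  apply: ell2_trunc_norm; first by rewrite invr_ge0 exprn_ge0.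
  rewrite (big_cat_nat (leq0n l) ln)/=.
  rewrite big_nat big1 ?add0r; last by move=> i /andP[_ ->]; rewrite expr0n.
  have -> : \sum_(l <= i < n) (if (i < l)%N then 0 else crd u i) ^+ 2 =
      energy n u - energy l u.
    rewrite (energyD _ ln) addrC addKr !big_nat; apply: eq_bigr => i /andP[li _].
    by rewrite ltnNge li.
  apply: le_trans (level_energy (stop_level k n u)) _.
  by rewrite exprVn -exprM mulnC exprM expr2 -natrM.
have sl : size (code k n u) = l by rewrite size_mkseq.
rewrite sl; set g := fun j : nat => _.
have -> : ell2_trunc l (crd u) - ell2_trunc l g =
    ell2_trunc l (fun j => crd u j - g j).
  apply: l2sum_eqP => i.
  change (trunc_seq l (crd u) i - trunc_seq l g i =
    trunc_seq l (fun j => crd u j - g j) i).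
  by rewrite /trunc_seq; case: ifP => //; rewrite subrr.
apply: ell2_trunc_norm; first by rewrite invr_ge0 exprn_ge0.
(* Rounding part: [l] errors of at most 2^-(k+l), and [l * 4 ^- (k + l) <= 4 ^- k]. *)
have p0 : 0 < 2 ^+ (k + l) :> R by exact: exprn_gt0.
apply: (@le_trans _ _ (\sum_(0 <= i < l) (2 ^- (k + l)) ^+ 2)).
  rewrite !big_nat; apply: ler_sum => i /andP[_ il].
  rewrite -[X in X <= _]real_normK ?num_real// lerXn2r ?nnegrE ?invr_ge0 ?exprn_ge0//.
  rewrite -(ler_pM2l p0) divff ?gt_eqF// -[X in X * _]gtr0_norm// -normrM mulrBr.
  rewrite /g nth_mkseq// mulrCA divff ?gt_eqF// mulr1.
  set x := _ * crd u i; have /andP[h1 h2] := floor_itv x.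
  by rewrite ger0_norm ?subr_ge0// lerBlDl; move: h2; rewrite intrD => /ltW.
rewrite sumr_const_nat subn0 exprD invfM exprMn -mulrnAr.
rewrite ler_piMr ?exprn_ge0 ?invr_ge0 ?exprn_ge0//.
rewrite -mulr_natl exprVn ler_pdivrMr ?exprn_gt0// mul1r -exprM -natrX ler_nat.
by rewrite (leq_trans (ltnW (ltn_expl l (ltnSn 1))))// leq_exp2l// leq_pmulr.
Qed.

(** Both values are compared with the truncation of [u] to [n] coordinates: 2/2^(k+1) + 2/2^k =
    3/2^k. *)
Lemma code_val_dist k n u : `|code_val k.+1 (code k.+1 n u) -
  code_val k (code k n u)| <= 3 / 2 ^+ k.
Proof.
rewrite -(subrK (ell2_trunc n (crd u)) (code_val k.+1 _)) -addrA.
apply: le_trans (ler_normD _ _) _.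
apply: le_trans (lerD _ (code_close k n u)) _.
  by rewrite distrC; exact: code_close.
rewrite exprS invfM mulrA divff ?mul1r// -[X in X + _]mul1r -mulrDl.
by rewrite ler_pM2r ?invr_gt0 ?exprn_gt0// -natr1 addrC natr1.
Qed.

Lemma code_val_coord k n u i : (i < n)%N ->
  `|crd u i - code_val k (code k n u) i| <= 2 / 2 ^+ k.
Proof.
move=> lt_in; apply: le_trans (code_close k n u).
apply: le_trans (l2sum_coord_le _ i).
by rewrite [X in `|X - _|](_ : _ = ell2_trunc n (crd u) i)// ell2_truncE lt_in.
Qed.

Lemma crd_le1 u i : `|crd u i| <= 1.
Proof.
have := crd1 u i.+1; rewrite big_nat_recr//= => h.
rewrite -(@ler_pXn2r _ 2) ?nnegrE// real_normK ?num_real// expr1n.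
by apply: le_trans h; rewrite lerDr; exact: energy_ge0.
Qed.

Fixpoint seqs_over (L : seq int) (m : nat) : seq (seq int) :=
  if m is m'.+1 then [::] :: [seq x :: t | x <- L, t <- seqs_over L m']
  else [:: [::]].

Lemma seqs_overP L m s : {subset s <= L} -> (size s <= m)%N -> s \in seqs_over L m.
Proof.
elim: m s => [|m IH] [|x s]//= sL sm.
by rewrite inE/=; apply/allpairsP; exists (x, s); split=> //=;
  [exact/sL/mem_head|apply: IH => // y ys; apply: sL; rewrite inE ys orbT].
Qed.

(** When [N] coordinates are available, a code has length at most [N] and entries of modulus at most
    2^(k+N). This finiteness provides the finite index sets in the convergence of the lifted
    series. *)
Lemma code_finite k N : exists G : seq (seq int), forall u, code k N u \in G.
Proof.
pose M := (2 ^ (k + N))%N.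
exists (seqs_over [seq i%:Z - M%:Z | i <- iota 0 (M + M).+1] N) => u.
apply: seqs_overP; last by rewrite size_mkseq; exact: stop_le.
move=> _ /mapP[j _ ->]; apply/mapP.
have [h1 h2] : 
  - M%:Z <= Num.floor (2 ^+ (k + stop k N u) * crd u j) /\
  Num.floor (2 ^+ (k + stop k N u) * crd u j) <= M%:Z.
  have : `|2 ^+ (k + stop k N u) * crd u j| <= M%:R :> R.
    rewrite normrM ger0_norm ?exprn_ge0// /M natrX.
    apply: (@le_trans _ _ (2 ^+ (k + stop k N u))).
      by rewrite ler_piMr ?exprn_ge0// crd_le1.
    by rewrite -!natrX ler_nat leq_exp2l// leq_add2l stop_le.
  rewrite ler_norml => /andP[h1 h2]; split.
    by rewrite floor_ge_int intrN.
  by rewrite -(ler_int R); exact: le_trans (floor_le _) h2.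
exists (absz (Num.floor (2 ^+ (k + stop k N u) * crd u j) + M%:Z)); last first.
  by rewrite gez0_abs ?addrK// -(opprK M%:Z) subr_ge0.
rewrite mem_iota add0n/= ltnS -lez_nat gez0_abs.
  by rewrite PoszD lerD2r.
by rewrite -(opprK M%:Z) subr_ge0.
Qed.

End codes.

(** * Lifting of a finitely additive measure to l_1 *)

Section double_limit.
Variables (R : realType) (I Fn U : Type) (A : I -> seq (Fn * U)).
Variables (G : set_system I) (H : set_system nat).
Hypotheses (UG : UltraFilter G) (UH : UltraFilter H).
Implicit Types (w : Fn -> R) (f : U -> R) (F : nat -> U -> R) (B M : R).

(** [A i] is a discrete measure on [U] with coefficients in [Fn]; these will be functionals, and [w]
    evaluates them at a vector z, or takes the modulus of this value. *)
Definition weighted_sum w f (i : I) : R := \sum_(p <- A i) w p.1 * f p.2.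

(** The inner limit integrates [F n] against the limit measure, which is only finitely additive; the
    outer one lets the number [n] of coordinates read tend to infinity. *)
Definition double_ulim w F : R := ulim H (fun n => ulim G (weighted_sum w (F n))).

Definition weight_le B w : Prop := forall i, \sum_(p <- A i) `|w p.1| <= B.

Lemma weighted_sum_bounded B M w f : 0 <= M ->
  weight_le B w -> bounded_by M f -> bounded_by (B * M) (weighted_sum w f).
Proof.
move=> M0 wB fM i; apply: le_trans (ler_norm_sum _ _ _) _.
apply: (@le_trans _ _ (\sum_(p <- A i) `|w p.1| * M)); last first.
  by rewrite -mulr_suml ler_wpM2r.
by apply: ler_sum => p _; rewrite normrM ler_wpM2l.
Qed.

Lemma inner_ulim_bounded B M w F : 0 <= M ->
  weight_le B w -> (forall n, bounded_by M (F n)) ->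
  bounded_by (B * M) (fun n => ulim G (weighted_sum w (F n))).
Proof.
move=> M0 wB FM n; apply: bounded_ulim => //.
exact: weighted_sum_bounded (FM n).
Qed.

Lemma weight_le_norm B w : weight_le B w -> weight_le B (fun c => `|w c|).
Proof. by move=> wB i; under eq_bigr do rewrite normr_id; exact: wB. Qed.

Lemma double_ulim_sum B w (J : Type) (s : seq J) (x : J -> R)
    (F : J -> nat -> U -> R) (M : J -> R) : weight_le B w ->
  (forall j, 0 <= M j) -> (forall j n, bounded_by (M j) (F j n)) ->
  double_ulim w (fun n u => \sum_(j <- s) x j * F j n u) =
  \sum_(j <- s) x j * double_ulim w (F j).
Proof.
move=> wB M0 FM; rewrite /double_ulim.
rewrite -(@ulim_sum _ _ _ UH _ s x _ (fun j => B * M j)); last first.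
  by move=> j; exact: inner_ulim_bounded (FM j).
congr ulim; apply/funext => n.
rewrite -(@ulim_sum _ _ _ UG _ s x _ (fun j => B * M j)); last first.
  by move=> j; exact: weighted_sum_bounded (FM j n).
congr ulim; apply/funext => i; rewrite /weighted_sum.
under eq_bigr do rewrite mulr_sumr; rewrite exchange_big/=.
by apply: eq_bigr => j _; rewrite mulr_sumr; apply: eq_bigr => p _; rewrite mulrCA.
Qed.

Lemma double_ulim_norm_le B w F F' M M' : weight_le B w -> 0 <= M -> 0 <= M' ->
  (forall n, bounded_by M (F n)) -> (forall n, bounded_by M' (F' n)) ->
  (\forall n \near H, forall u, `|F n u| <= F' n u) ->
  `|double_ulim w F| <= double_ulim (fun c => `|w c|) F'.
Proof.
move=> wB M0 M'0 FM F'M FF'; have wB' := weight_le_norm wB.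
apply: (ulim_normr_le UH (inner_ulim_bounded M0 wB FM)
  (inner_ulim_bounded M'0 wB' F'M)).
apply: filterS FF' => n Fn'.
apply: (ulim_normr_le UG (weighted_sum_bounded M0 wB (FM n))
  (weighted_sum_bounded M'0 wB' (F'M n))).
apply: nearW => i; apply: le_trans (ler_norm_sum _ _ _) _.
by apply: ler_sum => p _; rewrite normrM ler_wpM2l.
Qed.

Lemma double_ulim_le_cst B w F (x : R) : weight_le B w ->
  0 <= x -> (forall n, bounded_by x (F n)) -> `|double_ulim w F| <= B * x.
Proof.
by move=> wB x0 Fx; apply: bounded_ulim => //; exact: inner_ulim_bounded.
Qed.

Lemma double_ulim_linear B1 B2 w1 w2 (b : R) F M : weight_le B1 w1 ->
  weight_le B2 w2 -> 0 <= M -> (forall n, bounded_by M (F n)) ->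
  double_ulim (fun c => b * w1 c + w2 c) F =
  b * double_ulim w1 F + double_ulim w2 F.
Proof.
move=> wB1 wB2 M0 FM.
have b1 := inner_ulim_bounded M0 wB1 FM; have b2 := inner_ulim_bounded M0 wB2 FM.
rewrite -(ulimZ UH b b1).
have bb (K : R) (V : Type) (g : V -> R) : bounded_by K g ->
    bounded_by (`|b| * K) (fun v => b * g v).
  by move=> gK v; rewrite normrM ler_wpM2l.
rewrite -(ulimD UH (bb _ _ _ b1) b2); congr ulim; apply/funext => n.
have c1 := weighted_sum_bounded M0 wB1 (FM n).
have c2 := weighted_sum_bounded M0 wB2 (FM n).
rewrite -(ulimZ UG b c1) -(ulimD UG (bb _ _ _ c1) c2); congr ulim.
apply/funext => i; rewrite /weighted_sum mulr_sumr -big_split/=.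
by apply: eq_bigr => p _; rewrite mulrDl mulrA.
Qed.

End double_limit.

Section tails.
Variable Z : eqType.

(* The index (F, m) asks for an approximation of T z on the first m coordinates,
   for z in the finite family F. *)
Definition tails : set_system (seq Z * nat) := [set S | exists i0 : seq Z * nat,
  forall i : seq Z * nat, {subset i0.1 <= i.1} -> (i0.2 <= i.2)%N -> S i].

Lemma tails_proper : ProperFilter tails.
Proof.
split; first by case=> i0 /(_ i0); apply.
split; first by exists ([::], 0%N).
  move=> P Q [[F m] hP] [[F' m'] hQ]; exists (F ++ F', maxn m m').
  move=> i sF hm; split; [apply: hP|apply: hQ].
  - by move=> z zF; apply: sF; rewrite /= mem_cat zF.
  - by apply: leq_trans hm; exact: leq_maxl.
  - by move=> z zF; apply: sF; rewrite /= mem_cat zF orbT.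
  - by apply: leq_trans hm; exact: leq_maxr.
by move=> P Q PQ [i0 h]; exists i0 => i h1 h2; apply: PQ; exact: h.
Qed.

End tails.

Section reindex.
Variables (R : realType) (K : eqType) (phi : nat -> K).

(** For each [k] at most the pair [(k, phi k)] contributes. Sums over arbitrary finite sets of
    indices are thereby compared with geometric series in [k]. *)
Lemma sum_graph (s : seq (nat * K)) (N : nat) (g : nat * K -> R) :
  uniq s -> (forall j, j \in s -> (j.1 < N)%N) ->
  \sum_(j <- s) g j * (phi j.1 == j.2)%:R =
  \sum_(0 <= k < N) g (k, phi k) * ((k, phi k) \in s)%:R.
Proof.
elim: s => [|j s IH] /=.
  by move=> _ _; rewrite big_nil big1// => k _; rewrite mulr0.
move=> /andP[js us] hN; rewrite big_cons IH//; last first.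
  by move=> i si; apply: hN; rewrite inE si orbT.
transitivity (\sum_(0 <= k < N) (g (k, phi k) * ((k, phi k) == j)%:R +
    g (k, phi k) * ((k, phi k) \in s)%:R)); last first.
  apply: eq_bigr => k _; rewrite -mulrDr inE; congr (_ * _).
  have [->|_] := eqVneq (k, phi k) j; last by rewrite add0r.
  by rewrite (negbTE js) addr0.
rewrite big_split/=; congr (_ + _).
have jN : (j.1 < N)%N by apply: hN; rewrite mem_head.
rewrite big_mkord (bigD1 (Ordinal jN))//= big1 ?addr0; last first.
  move=> k kj; have [kE|_] := eqVneq (nat_of_ord k, phi k) j; last by rewrite mulr0.
  by case/eqP: kj; apply: val_inj; rewrite /= -kE.
case: j {js hN jN} => k x /=.
have [->|nx] := eqVneq (phi k) x; first by rewrite eqxx.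
by rewrite mulr0 (_ : _ == _ = false) ?mulr0//; apply/eqP => -[] /eqP; rewrite (negbTE nx).
Qed.

End reindex.

(** The sum telescopes, as 3/2^k = 6/2^k - 6/2^(k+1). *)
Lemma sum_pow2 (R : realType) (K N : nat) :
  \sum_(K <= k < N) 3 / 2 ^+ k <= 6 / 2 ^+ K :> R.
Proof.
have [KN|NK] := leqP K N; last first.
  by rewrite big_geq ?(ltnW NK)// divr_ge0// exprn_ge0.
suff : \sum_(K <= k < N) 3 / 2 ^+ k = 6 / 2 ^+ K - 6 / 2 ^+ N :> R.
  by move=> ->; rewrite gerBl divr_ge0// exprn_ge0.
rewrite -(opprB (6 / 2 ^+ N)) -(telescope_sumr (fun k => 6 / 2 ^+ k : R) KN).
rewrite -sumrN; apply: eq_bigr => k _.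
rewrite opprB exprS invfM mulrA.
have -> : 6 / 2 = 3 :> R by rewrite -[6]/((3 * 2)%:R) natrM mulfK.
by rewrite -mulrBl; congr (_ / _); rewrite -natrB.
Qed.

(** * Coefficients of the lifting, as measures of sets of given codes *)

Section lift_coefficients.
Variables (R : realType) (Z : normedModType R) (T : Z -> ell2 R) (C : R).
Variables (U : Type) (crd : U -> nat -> R).
Hypothesis crd1 : forall u N, \sum_(0 <= j < N) crd u j ^+ 2 <= 1.
Variable A : seq Z * nat -> seq ({linear Z -> R^o} * U).
Hypothesis A_sum : forall i z, \sum_(p <- A i) `|p.1 z| <= C * `|z|.
Hypothesis A_approx : forall (i : seq Z * nat) z j, z \in i.1 -> (j < i.2)%N ->
  `|\sum_(p <- A i) p.1 z * crd p.2 j - T z j| <= i.2.+1%:R^-1.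

Variables (G : set_system (seq Z * nat)) (H : set_system nat).
Hypotheses (UG : UltraFilter G) (UH : UltraFilter H).
Hypotheses (tG : @tails Z `<=` G) (tH : \oo `<=` H).

Local Notation J := (nat * (seq int * seq int))%type.

(** An index [(k, (s, t))] stands for the set of the [u] whose codes at precisions [k] and [k.+1]
    are [s] and [t]: [ind] is its indicator when [n] coordinates are read, [a] its limit measure,
    and [dvec] the increment of the telescoping sum there. [V z] integrates against the limit of the
    variations. *)
Let phi k n u : seq int * seq int := (code crd k n u, code crd k.+1 n u).
Let dvec (j : J) : ell2 R := code_val R j.1.+1 j.2.2 - code_val R j.1 j.2.1.
Let ind (j : J) n u : R := (phi j.1 n u == j.2)%:R.
Let ev (z : Z) : {linear Z -> R^o} -> R := fun c => c z.
Let V z F := double_ulim A G H (fun c => `|ev z c|) F.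
Let a (j : J) (z : Z) : R := double_ulim A G H (ev z) (ind j).

Let PG : ProperFilter G := @ultra_proper _ _ UG.
Let PH : ProperFilter H := @ultra_proper _ _ UH.

Let evB z : weight_le A (C * `|z|) (ev z).
Proof. by move=> i; exact: A_sum. Qed.

Let VB z : weight_le A (C * `|z|) (fun c => `|ev z c|).
Proof. exact: weight_le_norm (evB z). Qed.

Let ind1 j n : bounded_by 1 (ind j n).
Proof. by move=> u; rewrite /ind normr_nat lern1 leq_b1. Qed.

Let ae (n0 : nat) (P : nat -> Prop) : (forall n, (n0 <= n)%N -> P n) ->
  \forall n \near H, P n.
Proof. by move=> h; apply: tH; exists n0. Qed.

Lemma lift_coef_linear j b x y : a j (b *: x + y) = b * a j x + a j y.
Proof.
have wE : ev (b *: x + y) = (fun c => b * ev x c + ev y c).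
  by apply/funext => c; exact: (linearP c).
rewrite /a wE; exact: (double_ulim_linear UG UH b (evB x) (evB y) ler01 (ind1 j)).
Qed.

Let bound_dvec k n u : `|dvec (k, phi k n u)| <= 3 / 2 ^+ k.
Proof. exact: code_val_dist. Qed.

Let big_index (s : seq J) (K : nat) :
  exists2 N, (K <= N)%N & forall j, j \in s -> (j.1 < N)%N.
Proof.
exists (K + \sum_(j <- s) j.1.+1)%N => [|j js]; first exact: leq_addr.
by rewrite (big_rem j)//= addnCA leq_addr.
Qed.

(** For a fixed [u], at most one index per [k] is active, with an increment of norm at most 3/2^k;
    the total is at most 6, and it is integrated against a variation of mass at most [C * |z|]. *)
Lemma lift_coef_sum z (s : seq J) : uniq s ->
  \sum_(j <- s) `|a j z| * `|dvec j| <= 6 * C * `|z|.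
Proof.
move=> us.
pose S n u := \sum_(j <- s) `|dvec j| * ind j n u.
have S6 n : bounded_by 6 (S n).
  move=> u; rewrite ger0_norm; last by apply: sumr_ge0 => j _; rewrite mulr_ge0.
  have [N _ hN] := big_index s 0.
  rewrite /S (@sum_graph R _ (fun k => phi k n u) s N (fun j => `|dvec j|))//.
  apply: (@le_trans _ _ (\sum_(0 <= k < N) 3 / 2 ^+ k)).
    apply: ler_sum => k _; apply: le_trans (bound_dvec k n u).
    by rewrite ler_piMr// lern1 leq_b1.
  by apply: le_trans (sum_pow2 R 0 N) _; rewrite expr0 divr1.
apply: (@le_trans _ _ (V z S)).
  rewrite /V (@double_ulim_sum _ _ _ _ A G H UG UH _ _ _ s (fun j => `|dvec j|) ind (fun=> 1) (VB z))//.
  apply: ler_sum => j _; rewrite mulrC ler_wpM2l//.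
  apply: (@double_ulim_norm_le _ _ _ _ A G H UG UH _ _ _ _ 1 1 (evB z)) => //; try exact: ind1.
  by apply: nearW => n u; rewrite normr_nat.
apply: le_trans (ler_norm _) _.
apply: le_trans (double_ulim_le_cst UG UH (VB z) _ S6) _ => //.
by rewrite mulrC mulrA.
Qed.

Lemma coord_ulim z i : double_ulim A G H (ev z) (fun n u => crd u i) = T z i.
Proof.
rewrite /double_ulim -[RHS](@ulim_cst _ _ H UH); congr ulim; apply/funext => _.
apply: (ulim_eq UG); apply/cvgrPdist_le => e e0.
(* Beyond this index coordinate [i] is covered and the error 1/(m'+1) is at most [e]. *)
pose m := maxn i.+1 (Num.trunc e^-1).
apply: tG; exists ([:: z], m) => -[F m'] /= zF mm'.
have zF' : z \in F by apply: zF; rewrite mem_head.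
have im' : (i < m')%N by apply: leq_trans mm'; exact: leq_maxl.
rewrite distrC; apply: le_trans (A_approx (i := (F, m')) zF' im') _ => /=.
rewrite -[leRHS]invrK lef_pV2 ?posrE ?invr_gt0//.
apply: le_trans (ltW (truncnS_gt _)) _; rewrite ler_nat ltnS.
by apply: leq_trans mm'; exact: leq_maxr.
Qed.

(** Indicator of the [u] whose codes at precisions [k] and [k.+1] differ between [N] and [n]
    coordinates. *)
Let bad k N n u : R := (phi k n u != phi k N u)%:R.

Let bad1 k N n : bounded_by 1 (bad k N n).
Proof. by move=> u; rewrite /bad normr_nat lern1 leq_b1. Qed.

Let lev k n u : R := (level crd k n u + level crd k.+1 n u)%:R.

Let levM k n : bounded_by (4 ^ k + 4 ^ k.+1)%:R (lev k n).
Proof.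
by move=> u; rewrite /lev normr_nat ler_nat leq_add// level_le.
Qed.

(* This replaces countable additivity: the levels, hence also their integrals,
   are nondecreasing in n and bounded, and a code changes only when a level does. *)
Lemma code_change_small z k (e : R) : 0 < e -> exists N, V z (bad k N) <= e.
Proof.
move=> e0; pose wt (c : {linear Z -> R^o}) : R := `|ev z c|.
pose v n := ulim G (weighted_sum A wt (lev k n)).
have wb f M : 0 <= M -> bounded_by M f ->
    bounded_by (C * `|z| * M) (weighted_sum A wt f).
  by move=> M0; apply: weighted_sum_bounded => //; exact: VB.
have vh : {homo v : m n / (m <= n)%N >-> m <= n}.
  move=> m n mn; apply: (ulim_le UG (wb _ _ _ (levM k m)) (wb _ _ _ (levM k n))) => //.
  apply: nearW => i; apply: ler_sum => p _; apply: ler_wpM2l; first exact: normr_ge0.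
  rewrite /lev ler_nat.
  by rewrite leq_add// level_homo.
have vM n : v n <= C * `|z| * (4 ^ k + 4 ^ k.+1)%:R.
  apply: le_trans (ler_norm _) _; apply: (bounded_ulim UG).
  exact: wb (levM k n).
have [N hN] := nondecreasing_bounded_cauchy vh vM e0.
exists N; rewrite /V /double_ulim -[leRHS](@ulim_cst _ _ H UH).
have ib := @inner_ulim_bounded _ _ _ _ A G UG _ 1 _ (bad k N) ler01 (VB z) (bad1 k N).
apply: (ulim_le UH ib (_ : bounded_by `|e| _)) => //.
apply: (@ae N) => n Nn; apply: le_trans (hN n Nn).
have bm := wb _ _ _ (levM k N).
have bNm : bounded_by (C * `|z| * (4 ^ k + 4 ^ k.+1)%:R)
    (fun i => -1 * weighted_sum A wt (lev k N) i).
  by move=> i; rewrite mulN1r normrN bm.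
rewrite /v -[X in _ <= _ + X]mulN1r -(ulimZ UG (-1) (bm _)) //.
rewrite -(ulimD UG (wb _ _ _ (levM k n)) bNm)//.
have bs : bounded_by (C * `|z| * (4 ^ k + 4 ^ k.+1)%:R + C * `|z| * (4 ^ k + 4 ^ k.+1)%:R)
  (fun i => weighted_sum A wt (lev k n) i + -1 * weighted_sum A wt (lev k N) i).
  move=> i; apply: le_trans (ler_normD _ _) _.
  by apply: lerD; [exact: (wb _ _ _ (levM k n))|exact: bNm].
apply: (ulim_le UG (wb _ _ _ (bad1 k N n)) bs) => //.
apply: nearW => i; rewrite mulN1r /weighted_sum -sumrB.
apply: ler_sum => p _; rewrite -mulrBr; apply: ler_wpM2l; first exact: normr_ge0.
rewrite /lev -natrB; last first.
  by rewrite leq_add// level_homo.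
have h1 := @level_homo _ _ crd k _ _ p.2 Nn.
have h2 := @level_homo _ _ crd k.+1 _ _ p.2 Nn.
(* The increase of [lev] is a natural number. If it is 0, both levels are unchanged because neither
   can decrease, and then so are both codes. *)
rewrite /bad ler_nat; case: (eqVneq (phi k n p.2)) => // /eqP bd /=.
rewrite lt0n subn_eq0 -ltnNge ltnNge; apply/negP => hle; apply: bd.
have e1 : level crd k n p.2 = level crd k N p.2.
  apply/eqP; rewrite eqn_leq h1 andbT -(leq_add2r (level crd k.+1 n p.2)).
  by apply: leq_trans hle _; rewrite leq_add2l.
have e2 : level crd k.+1 n p.2 = level crd k.+1 N p.2.
  apply/eqP; rewrite eqn_leq h2 andbT -(leq_add2l (level crd k n p.2)).
  by apply: leq_trans hle _; rewrite leq_add2r.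
by rewrite /phi (code_eq e1) (code_eq e2).
Qed.

Let coord_graph_le (s : seq J) n u i : uniq s ->
  `|\sum_(j <- s) dvec j i * ind j n u| <= 6.
Proof.
move=> us; have [N _ hN] := big_index s 0.
rewrite (@sum_graph R _ (fun k => phi k n u) s N (fun j => dvec j i))//.
apply: le_trans (ler_norm_sum _ _ _) _.
apply: (@le_trans _ _ (\sum_(0 <= k < N) 3 / 2 ^+ k)).
  apply: ler_sum => k _; apply: le_trans (bound_dvec k n u).
  rewrite normrM normr_nat; apply: le_trans (l2sum_coord_le _ i).
  by rewrite ler_piMr// lern1 leq_b1.
by apply: le_trans (sum_pow2 R 0 N) _; rewrite expr0 divr1.
Qed.

(** The indices below [K] telescope, from the value 0 at [k = 0], to the value of the code at
    precision [K], which costs 2/2^K. Those from [K] on contribute at most 6/2^K, whichever of them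
    belong to [s]. *)
Let coord_approx (K : nat) (s : seq J) n u i : uniq s -> (i < n)%N ->
  (forall k, (k < K)%N -> (k, phi k n u) \in s) ->
  `|crd u i - \sum_(j <- s) dvec j i * ind j n u| <= 8 / 2 ^+ K.
Proof.
move=> us lt_in hs; have [N KN hN] := big_index s K.
rewrite (@sum_graph R _ (fun k => phi k n u) s N (fun j => dvec j i))//.
rewrite (big_cat_nat (leq0n K) KN)/= opprD addrA.
have -> : \sum_(0 <= k < K) dvec (k, phi k n u) i * ((k, phi k n u) \in s)%:R =
    code_val R K (code crd K n u) i.
  have -> : code_val R K (code crd K n u) i =
      code_val R K (code crd K n u) i - code_val R 0 (code crd 0 n u) i.
    by rewrite /= subr0.
  rewrite -(telescope_sumr (fun k => code_val R k (code crd k n u) i : R) (leq0n K)).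
  by rewrite !big_nat; apply: eq_bigr => k /andP[_ kK]; rewrite hs// mulr1.
apply: le_trans (ler_normB _ _) _.
have -> : 8 / 2 ^+ K = 2 / 2 ^+ K + 6 / 2 ^+ K :> R by rewrite -mulrDl -natrD.
apply: lerD; first exact: (code_val_coord crd1 K u lt_in).
apply: le_trans (ler_norm_sum _ _ _) _; apply: le_trans (sum_pow2 R K N).
apply: ler_sum => k _; apply: le_trans (bound_dvec k n u).
rewrite normrM normr_nat; apply: le_trans (l2sum_coord_le _ i).
by rewrite ler_piMr// lern1 leq_b1.
Qed.

Let phi_finite k N : exists L : seq (seq int * seq int), forall u, phi k N u \in L.
Proof.
have [L1 h1] := code_finite crd1 k N; have [L2 h2] := code_finite crd1 k.+1 N.
exists [seq (x, y) | x <- L1, y <- L2] => u.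
by apply/allpairsP; exists (phi k N u); split=> /=; rewrite ?h1 ?h2.
Qed.

(** [T z i] is the integral of the coordinate [i]. The integrand of the difference is at most 8/2^K
    where no code of precision up to [K] changes late, and at most 7 elsewhere, on a set of small
    variation. *)
Lemma lift_coef_cvg z i (e : R) : 0 < e -> exists s0 : seq J, forall s, uniq s ->
  {subset s0 <= s} -> `|T z i - \sum_(j <- s) a j z * dvec j i| <= e.
Proof.
(* [K] makes the integral of the constant 8/2^K at most e/2. *)
move=> e0; pose K := (Num.trunc (16 * (C * `|z|) / e)).+1.
have hK : 8 / 2 ^+ K * (C * `|z|) <= e / 2.
  have : 16 * (C * `|z|) / e <= 2 ^+ K.
    apply: le_trans (ltW (truncnS_gt _)) _.
    by rewrite -natrX ler_nat ltnW// ltn_expl.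
  rewrite ler_pdivrMr// [_ * e]mulrC -ler_pdivrMr ?exprn_gt0// => h.
  have -> : 8 / 2 ^+ K * (C * `|z|) = 16 * (C * `|z|) / 2 ^+ K / 2.
    by field; rewrite expf_neq0.
  by rewrite ler_pM2r ?invr_gt0.
(* There are [K] exceptional sets, each weighted by 7: [7 * K * eta = e / 2]. *)
pose eta := e / (14 * K%:R).
have eta0 : 0 < eta by rewrite divr_gt0// mulr_gt0// ltr0n.
have [Nk hNk] := choice (fun k => code_change_small z k eta0).
have [L hL] := choice (fun k => phi_finite k (Nk k)).
(* All pairs of codes that can occur with [Nk k] coordinates, for [k < K]. *)
exists [seq (k, t) | k <- iota 0 K, t <- L k] => s us sub.
pose D n u := crd u i - \sum_(j <- s) dvec j i * ind j n u.
(* [None] indexes the coordinate itself and [Some j] the terms subtracted, so that [D] is one finite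
   linear combination. *)
pose x (o : option J) : R := if o is Some j then - dvec j i else 1.
pose F (o : option J) n u : R := if o is Some j then ind j n u else crd u i.
have F1 o n : bounded_by 1 (F o n).
  by case: o => [j|]; [exact: ind1|move=> u; exact: crd_le1].
have DE n u : D n u = \sum_(o <- None :: map Some s) x o * F o n u.
  rewrite big_cons big_map /= mul1r /D -sumrN; congr (_ + _).
  by apply: eq_bigr => j _; rewrite mulNr.
have -> : T z i - \sum_(j <- s) a j z * dvec j i = double_ulim A G H (ev z) D.
  have -> : D = fun n u => \sum_(o <- None :: map Some s) x o * F o n u.
    by apply/funext => n; apply/funext => u; exact: DE.
  rewrite (@double_ulim_sum _ _ _ _ A G H UG UH _ _ _ _ x F (fun=> 1) (evB z))//.
  rewrite big_cons big_map /= mul1r coord_ulim -sumrN; congr (_ + _).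
  by apply: eq_bigr => j _; rewrite mulNr mulrC.
(* The dominating function has the same form: [None] is the constant 8/2^K, [Some k] the exceptional
   set of [k] with weight 7. *)
pose x' (o : option nat) : R := if o is Some k then 7 else 8 / 2 ^+ K.
pose F' (o : option nat) n u : R := if o is Some k then bad k (Nk k) n u else 1.
have F'1 o n : bounded_by 1 (F' o n).
  by case: o => [k|]; [exact: bad1|move=> u /=; rewrite normr1].
pose D' n u := \sum_(o <- None :: map Some (iota 0 K)) x' o * F' o n u.
have x'0 o : 0 <= x' o by case: o => [k|]//=; rewrite divr_ge0// exprn_ge0.
have F'0 o n u : 0 <= F' o n u by case: o => [k|]//=; rewrite ler0n.
pose M' := \sum_(o <- None :: map Some (iota 0 K)) x' o.
have M'0 : 0 <= M' by apply: sumr_ge0.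
have D'M n : bounded_by M' (D' n).
  move=> u; apply: le_trans (ler_norm_sum _ _ _) _; apply: ler_sum => o _.
  by rewrite normrM (ger0_norm (x'0 o)) ler_piMr// F'1.
have D7 n : bounded_by 7 (D n).
  move=> u; apply: le_trans (ler_normB _ _) _.
  have -> : 7 = 1 + 6 :> R by rewrite -[1]/(1%:R) -natrD.
  by apply: lerD; [exact: crd_le1|exact: coord_graph_le].
have DD' : \forall n \near H, forall u, `|D n u| <= D' n u.
  apply: (@ae i.+1) => n lt_in u.
  have [good|/existsNP[k /not_implyP[kK /negP kbad]]] := pselect (forall k, (k < K)%N ->
      phi k n u == phi k (Nk k) u).
    rewrite /D' big_cons /= mulr1.
    apply: le_trans (@coord_approx K s n u i us lt_in _) _; last first.
      by rewrite lerDl; apply: sumr_ge0 => o _; rewrite mulr_ge0.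
    move=> k kK; apply: sub; apply/allpairsPdep; exists k, (phi k n u).
    by split=> //; [rewrite mem_iota add0n kK|rewrite (eqP (good k kK)) hL].
  apply: le_trans (D7 n u) _; rewrite /D' big_cons big_map /= mulr1.
  have kin : k \in iota 0 K by rewrite mem_iota add0n.
  rewrite (bigD1_seq k kin (iota_uniq 0 K))/=.
  rewrite {1}/bad kbad mulr1 addrCA lerDl; apply: addr_ge0.
    exact: (x'0 None).
  by apply: sumr_ge0 => k' _; rewrite mulr_ge0.
apply: le_trans (double_ulim_norm_le UG UH (evB z) _ M'0 D7 D'M DD') _ => //.
rewrite -/(V z D') /V /D'.
rewrite (@double_ulim_sum _ _ _ _ A G H UG UH _ _ _ _ x' F' (fun=> 1) (VB z))//.
rewrite big_cons big_map /=.
rewrite [leRHS](splitr e); apply: lerD.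
  apply: le_trans hK; rewrite ler_wpM2l// ?divr_ge0 ?exprn_ge0//.
  apply: le_trans (ler_norm _) _.
  apply: le_trans (double_ulim_le_cst UG UH (VB z) ler01 (F'1 None)) _.
  by rewrite mulr1.
apply: (@le_trans _ _ (\sum_(0 <= k < K) 7 * eta)).
  rewrite /index_iota subn0; apply: ler_sum => k _; rewrite ler_wpM2l//.
  exact: hNk.
rewrite sumr_const_nat subn0 -mulr_natr /eta le_eqVlt; apply/orP; left.
by apply/eqP; field; rewrite pnatr_eq0.
Qed.

End lift_coefficients.

Section lifting.
Variables (R : realType) (Z : normedModType R) (T : Z -> ell2 R) (C : R).

Definition unit_ball : Type := {b : ell2 R | `|b| <= 1}.

Definition unit_ball_coord (u : unit_ball) (j : nat) : R := (sval u : ell2 R) j.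

Lemma unit_ball_coord_sum u N : \sum_(0 <= j < N) unit_ball_coord u j ^+ 2 <= 1.
Proof.
have := l2sum_partial_le (sval u) N.
under eq_bigr do rewrite real_normK ?num_real//.
by move=> /le_trans; apply; rewrite exprn_ile1//; exact: (svalP u).
Qed.

Hypothesis approx : forall (F : seq Z) (m : nat),
  exists s : seq ({linear Z -> R^o} * unit_ball),
    (forall z, \sum_(p <- s) `|p.1 z| <= C * `|z|) /\
    (forall z j, z \in F -> (j < m)%N ->
      `|\sum_(p <- s) p.1 z * unit_ball_coord p.2 j - T z j| <= m.+1%:R^-1).

(** By choice the hypothesis yields a net of discrete measures on the unit ball; ultrafilters
    refining the tails of its index set and of the integers give the limits. The factor 6 is the sum
    of the 3/2^k, and the convergence has the form asked for by [family_factorization]. *)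
Lemma ell1_lifting :
  exists (a : nat * (seq int * seq int) -> Z -> R)
    (d : nat * (seq int * seq int) -> ell2 R),
  [/\ forall j b x y, a j (b *: x + y) = b * a j x + a j y,
      forall z s, uniq s -> \sum_(j <- s) `|a j z| * `|d j| <= 6 * C * `|z| &
      forall z i e, 0 < e -> exists s0 : seq (nat * (seq int * seq int)),
        forall s, uniq s -> {subset s0 <= s} ->
        `|T z i - \sum_(j <- s) a j z * d j i| <= e].
Proof.
have [A hA] := choice (fun i : seq Z * nat => approx i.1 i.2).
have A_sum i z : \sum_(p <- A i) `|p.1 z| <= C * `|z| by have [h _] := hA i.
have A_approx (i : seq Z * nat) z j : z \in i.1 -> (j < i.2)%N ->
    `|\sum_(p <- A i) p.1 z * unit_ball_coord p.2 j - T z j| <= i.2.+1%:R^-1.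
  by have [_] := hA i; exact.
have [G [UG tG]] := ultraFilterLemma (tails_proper Z).
have [H [UH tH]] := @ultraFilterLemma nat \oo _.
do 2 eexists; split.
- exact: (lift_coef_linear unit_ball_coord A_sum UG UH).
- exact: (lift_coef_sum unit_ball_coord_sum A_sum UG UH).
- exact: (lift_coef_cvg unit_ball_coord_sum A_sum A_approx UG UH tG tH).
Qed.

End lifting.

(** * Discretization of a factorization through L_1 *)

Section averaging.
Context d (W : measurableType d) (R : realType) (nu : {measure set W -> \bar R}).
Implicit Types (D : set W) (f g : L1 nu).

Definition L1_int D f : R := \int[nu]_(x in D) f x.

Lemma L1_integrable f D : measurable D -> nu.-integrable D (EFin \o (f : W -> R)).
Proof.
move=> mD; apply: (@integrableS _ _ _ nu setT) => //.
by apply/Lfun1_integrable; exact: L1_Lfun.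
Qed.

Lemma L1_measurable f D : measurable_fun D (EFin \o (f : W -> R)).
Proof.
apply: measurable_funS (measurableT) (@subsetT _ D) _.
by apply/measurable_EFinP; exact: L1_funM.
Qed.

Lemma L1_int_ae D (h1 h2 : W -> R) : measurable D ->
  measurable_fun setT h1 -> measurable_fun setT h2 ->
  (\forall x \ae nu, h1 x = h2 x) ->
  \int[nu]_(x in D) h1 x = \int[nu]_(x in D) h2 x.
Proof.
move=> mD m1 m2 h; congr fine; apply: ae_eq_integral => //.
- apply: measurable_funS (measurableT) (@subsetT _ D) _.
  exact/measurable_EFinP.
- apply: measurable_funS (measurableT) (@subsetT _ D) _.
  exact/measurable_EFinP.
- by apply: filterS h => x /= ->.
Qed.

Lemma L1_int_linear D : measurable D ->
  forall b f g, L1_int D (b *: f + g) = b * L1_int D f + L1_int D g.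
Proof.
move=> mD b f g; rewrite /L1_int -RintegralZl//; last exact: L1_integrable.
rewrite -RintegralD//; last 2 first.
- exact: (integrableZl mD b (L1_integrable f mD)).
- exact: L1_integrable.
apply: L1_int_ae => //.
- exact: L1_funM.
- apply: measurable_funD; last exact: L1_funM.
  by apply: measurable_funM => //; exact: L1_funM.
apply: filterS2 (L1_addE (b *: f) g) (L1_scaleE b f) => x E1 E2.
by rewrite -E2 -E1.
Qed.

Section cells.
Variables (K : eqType) (h : W -> K) (Vs : seq K).
Hypothesis uVs : uniq Vs.
Let cell v := h @^-1` [set v].
Hypothesis mcell : forall v, measurable (cell v).
Hypothesis fcell : forall v, v \in Vs -> (nu (cell v) < +oo)%E.

Let sum_indic_le1 x : \sum_(v <- Vs) \1_(cell v) x <= 1 :> R.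
Proof.
have [hx|hx] := boolP (h x \in Vs); last first.
  rewrite big_seq big1// => v vV; rewrite indicE memNset// => hv.
  by move: hx; rewrite hv vV.
rewrite (bigD1_seq (h x))//= big1 ?addr0.
  by rewrite indicE mem_set.
move=> v vh; rewrite indicE memNset// => hv.
by rewrite -hv eqxx in vh.
Qed.

(** The cells are disjoint, so the integrals of [|f|] over them add up to at most its norm. *)
Lemma sum_L1_int_le f : \sum_(v <- Vs) `|L1_int (cell v) f| <= `|f|.
Proof.
rewrite -lee_fin L1_normrE -sumEFin.
apply: (@le_trans _ _ (\sum_(v <- Vs) \int[nu]_x (`|f x| * \1_(cell v) x)%:E)%E).
  apply: lee_sum => v _; rewrite EFin_normr_Rintegral//; last exact: L1_integrable.
  apply: le_trans (le_abse_integral _ _ _) _ => //.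
    exact: L1_measurable.
  rewrite integral_mkcond le_eqVlt; apply/orP; left; apply/eqP.
  apply: eq_integral => x _; rewrite patchE indicE.
  by case: ifP => _; rewrite ?mulr1 ?mulr0.
have mf : measurable_fun setT (fun x => `|f x|).
  by apply: measurableT_comp => //; exact: L1_funM.
have mfv v : measurable_fun setT (fun x => (`|f x| * \1_(cell v) x)%:E).
  by apply/measurable_EFinP; exact: measurable_funM.
rewrite -(ge0_integral_sum _ measurableT mfv); last first.
  by move=> v x _; rewrite lee_fin mulr_ge0.
apply: ge0_le_integral => //.
- by move=> x _; rewrite sumEFin lee_fin sumr_ge0// => v _; rewrite mulr_ge0.
- by apply: emeasurable_sum => v; exact: mfv.
- exact/measurable_EFinP.
- by move=> x _; rewrite sumEFin lee_fin -mulr_sumr ler_piMr// sum_indic_le1.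
Qed.

Lemma indic_Lfun v : v \in Vs -> \1_(cell v) \in Lfun nu 1.
Proof.
move=> vV; apply/Lfun1_integrable/integrableP; split.
  by apply/measurable_EFinP.
under eq_integral do rewrite /= ger0_norm//.
by rewrite integral_indic// setIT fcell.
Qed.

(** Integrability comes from the finite measure of the cell, which is assumed for [v] in [Vs];
    elsewhere the value 0 is a default. *)
Definition L1_indic v : L1 nu :=
  if pselect (v \in Vs) is left vV then L1_of (indic_Lfun vV) else 0.

Lemma L1_indicE v : v \in Vs -> \forall x \ae nu, L1_indic v x = \1_(cell v) x.
Proof. by move=> vV; rewrite /L1_indic; case: pselect => // vV'; exact: L1_ofE. Qed.

Lemma L1_indic_int v w : v \in Vs ->
  L1_int (cell w) (L1_indic v) = if v == w then fine (nu (cell v)) else 0.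
Proof.
move=> vV; rewrite /L1_int (@L1_int_ae _ _ (\1_(cell v)))//.
- rewrite /Rintegral integral_indic//; case: eqVneq => [->|vw].
    by rewrite setIid.
  rewrite (_ : _ `&` _ = set0) ?measure0//; apply/seteqP; split=> // x [/= hv hw].
  by rewrite -hv hw eqxx in vw.
- exact: L1_funM.
- exact: L1_indicE.
Qed.

Lemma L1_indic_norm v : v \in Vs -> `|L1_indic v| = fine (nu (cell v)).
Proof.
move=> vV; apply: EFin_inj; rewrite L1_normrE fineK; last first.
  by rewrite ge0_fin_numE ?fcell.
transitivity (nu (cell v `&` setT)); last by rewrite setIT.
rewrite -(@integral_indic _ _ _ nu setT)//.
apply: ae_eq_integral => //.
- by apply/measurable_EFinP; apply: measurableT_comp => //; exact: L1_funM.
- exact/measurable_EFinP.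
- by apply: filterS (L1_indicE vV) => x -> _; rewrite ger0_norm.
Qed.

(* When the cell is negligible, [L1_indic v] and its multiple [L1_atom v] are 0. *)
Definition L1_atom v : L1 nu := (fine (nu (cell v)))^-1 *: L1_indic v.

Lemma L1_atom_norm v : v \in Vs -> `|L1_atom v| <= 1.
Proof.
move=> vV; rewrite normrZ L1_indic_norm// normfV ger0_norm ?fine_ge0//.
by have [->|n0] := eqVneq (fine (nu (cell v))) 0; rewrite ?mulr0// mulVf.
Qed.

(** The conditional expectation on the finitely many cells of [Vs]. *)
Definition L1_average f : L1 nu := \sum_(v <- Vs) L1_int (cell v) f *: L1_atom v.

Lemma L1_average_norm f : `|L1_average f| <= `|f|.
Proof.
apply: le_trans (sum_L1_int_le f); apply: le_trans (ler_norm_sum _ _ _) _.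
rewrite !big_seq; apply: ler_sum => v vV.
by rewrite normrZ ler_piMr// L1_atom_norm.
Qed.

Lemma L1_averageB f g : L1_average (f - g) = L1_average f - L1_average g.
Proof.
rewrite /L1_average -sumrB; apply: eq_bigr => v _.
by rewrite -scalerBl -scaleN1r addrC L1_int_linear// mulN1r addrC.
Qed.

Lemma L1_average_cells (y : K -> R) :
  L1_average (\sum_(v <- Vs) y v *: L1_indic v) =
  \sum_(v <- Vs) y v *: L1_indic v.
Proof.
have int_sum w (s : seq K) : L1_int (cell w) (\sum_(v <- s) y v *: L1_indic v) =
    \sum_(v <- s) y v * L1_int (cell w) (L1_indic v).
  elim: s => [|v s IH]; last by rewrite !big_cons L1_int_linear// IH.
  rewrite !big_nil; have := L1_int_linear (mcell w) (-1) 0 0.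
  by rewrite scaler0 addr0 mulN1r addNr.
rewrite /L1_average !big_seq; apply: eq_bigr => w wV.
rewrite -!big_seq int_sum (bigD1_seq w)//= big1_seq ?addr0; last first.
  by move=> v /andP[vw vV]; rewrite L1_indic_int// (negbTE vw) mulr0.
rewrite L1_indic_int// eqxx /L1_atom scalerA.
(* On a negligible cell both sides are 0. *)
have [n0|n0] := eqVneq (fine (nu (cell w))) 0; last by rewrite mulfK.
have -> : L1_indic w = 0 by apply/eqP; rewrite -normr_eq0 L1_indic_norm// n0.
by rewrite !scaler0.
Qed.

(** Averaging is a contraction that fixes step functions on the cells, whence the factor 2. *)
Lemma L1_average_dist f (y : K -> R) :
  `|f - L1_average f| <= 2 * `|f - \sum_(v <- Vs) y v *: L1_indic v|.
Proof.
set g := \sum_(v <- Vs) _.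
have -> : f - L1_average f = (f - g) - L1_average (f - g).
  by rewrite L1_averageB (L1_average_cells y) -/g opprB addrA subrK.
apply: le_trans (ler_normB _ _) _.
by rewrite mulr_natl mulr2n lerD2l; exact: L1_average_norm.
Qed.

End cells.

End averaging.

Section discretization.
Context d (W : measurableType d) (R : realType) (nu : {measure set W -> \bar R}).
Implicit Types (f g : L1 nu).

Lemma L1_sumE (J : Type) (s : seq J) (F : J -> L1 nu) :
  \forall x \ae nu, (\sum_(j <- s) F j) x = \sum_(j <- s) F j x.
Proof.
elim: s => [|j s IH].
  rewrite big_nil; apply: filterS (L1_zeroE nu) => x E0.
  by rewrite big_nil -E0.
rewrite big_cons; apply: filterS2 (L1_addE (F j) (\sum_(k <- s) F k)) IH => x E1 E2.
by rewrite big_cons -E2 -E1.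
Qed.

Lemma L1_simple_approx f (e : R) : 0 < e ->
  exists g : {sfun W >-> R}, nu.-integrable setT (EFin \o g) /\
    (\int[nu]_x `|f x - g x|%:E <= e%:E)%E.
Proof.
move=> e0; have := approximation_sfun_integrable measurableT (L1_integrable f measurableT).
move=> [g [gi _ gcv]].
have /fine_cvgP[fin /cvgrPdist_le/(_ e e0) small] := gcv.
have [n [nf ns]] := filter_ex (filterI fin small).
exists (g n); split; first exact: gi.
rewrite -[X in (X <= _)%E]fineK// lee_fin.
by move: ns; rewrite /= sub0r normrN; exact/le_trans/ler_norm.
Qed.

Section common_cells.
Variables (fs : seq (L1 nu)) (G : L1 nu -> {sfun W >-> R}).

(** The fibres of this map are common cells: all the simple functions [G f] are constant on each of
    them. *)
Definition sfun_values (x : W) : seq R := [seq G f x | f <- fs].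

Lemma sfun_values_finite : finite_set (range sfun_values).
Proof.
rewrite /sfun_values; elim: fs => [|f s IH] /=.
  by apply: (@sub_finite_set _ _ [set [::]]) => // _ [x _ <-].
exact: (finite_image11 cons (fimfunP (G f)) IH).
Qed.

Lemma sfun_values_measurable v : measurable (sfun_values @^-1` [set v]).
Proof.
rewrite /sfun_values; elim: fs v => [|f s IH] v.
  case: v => [|a v].
    by rewrite (_ : _ @^-1` _ = setT)//; apply/seteqP; split.
  by rewrite (_ : _ @^-1` _ = set0)//; apply/seteqP; split.
case: v => [|a v].
  by rewrite (_ : _ @^-1` _ = set0)//; apply/seteqP; split.
rewrite (_ : _ @^-1` _ = (G f @^-1` [set a]) `&`
    ((fun x => [seq G f' x | f' <- s]) @^-1` [set v])).
  by apply: measurableI; [exact: measurable_funPTI|exact: IH].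
by apply/seteqP; split => x /= => [[-> ->]//|[-> ->]].
Qed.

(** On this cell the integrable function [G f] is a nonzero constant. *)
Lemma sfun_cell_lty f v : f \in fs -> nu.-integrable setT (EFin \o G f) ->
  nth 0 v (index f fs) != 0 -> (nu (sfun_values @^-1` [set v]) < +oo)%E.
Proof.
move=> ffs Gi; set a := nth 0 v _ => a0.
have mD := sfun_values_measurable v; set D := _ @^-1` _ in mD *.
have /integrableP[mG] := integrableS measurableT mD (@subsetT _ D) Gi.
have aD x : D x -> G f x = a.
  by move=> /= Dx; rewrite /a -Dx (nth_map f) ?index_mem// nth_index.
rewrite (eq_integral (cst `|a|%:E)); last by move=> x /set_mem/aD /= ->.
rewrite integral_cst// => h.
rewrite -(@lte_pmul2l _ `|a|%:E) ?lte_fin ?normr_gt0//.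
by rewrite gt0_muley// lte_fin normr_gt0.
Qed.

End common_cells.

(** Simple functions are chosen close to the members of [fs], and every function is averaged over
    their common cells of finite measure. *)
Lemma L1_discretize (fs : seq (L1 nu)) (e : R) : 0 < e ->
  exists (Vs : seq (seq R)) (c : seq R -> L1 nu -> R) (b : seq R -> L1 nu),
  [/\ forall v r f g, c v (r *: f + g) = r * c v f + c v g,
      forall f, \sum_(v <- Vs) `|c v f| <= `|f|,
      forall v, v \in Vs -> `|b v| <= 1 &
      forall f, f \in fs -> `|f - \sum_(v <- Vs) c v f *: b v| <= e].
Proof.
move=> e0.
(* Half of [e], since averaging doubles the distance to a step function. *)
have [G hG] := choice (fun f => L1_simple_approx f (divr_gt0 e0 (ltr0n R 2))).
pose h := sfun_values fs G.
have [s sE] := (finite_seqP _).1 (sfun_values_finite fs G).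
pose Vs := [seq v <- undup s | `[< (nu (h @^-1` [set v]) < +oo)%E >]].
have uVs : uniq Vs by rewrite filter_uniq// undup_uniq.
have mcell := sfun_values_measurable fs G.
have fcell v : v \in Vs -> (nu (h @^-1` [set v]) < +oo)%E.
  by rewrite mem_filter => /andP[/asboolP].
exists Vs, (fun v => L1_int (h @^-1` [set v])), (L1_atom mcell fcell); split.
- by move=> v r f g; exact: L1_int_linear.
- by move=> f; exact: sum_L1_int_le.
- by move=> v vV; exact: L1_atom_norm.
move=> f ffs; pose y v : R := nth 0 v (index f fs).
apply: le_trans (L1_average_dist uVs mcell fcell f y) _.
rewrite mulrC -ler_pdivlMr//.
have [Gi Ge] := hG f; rewrite -lee_fin L1_normrE; apply: le_trans Ge.
rewrite le_eqVlt; apply/orP; left; apply/eqP.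
set g := \sum_(v <- Vs) _.
have gE : \forall x \ae nu, g x = G f x.
  have all_indic (t : seq (seq R)) : {subset t <= Vs} ->
      \forall x \ae nu, \sum_(v <- t) (y v *: L1_indic mcell fcell v) x =
        \sum_(v <- t) y v * \1_(h @^-1` [set v]) x.
    elim: t => [|v t IH] tV; first by apply: aeW => x; rewrite !big_nil.
    have vV : v \in Vs by apply: tV; rewrite mem_head.
    have {}/IH : {subset t <= Vs} by move=> w wt; apply: tV; rewrite inE wt orbT.
    apply: filterS3 (L1_scaleE (y v) (L1_indic mcell fcell v)) (L1_indicE mcell fcell vV).
    by move=> x E1 E2 E3; rewrite !big_cons -E3 -E2 -E1.
  have := all_indic Vs (fun=> id).
  apply: filterS2 (L1_sumE Vs (fun v => y v *: L1_indic mcell fcell v)) => x E1 E2.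
  rewrite [LHS]E1 [LHS]E2.
  have yE : y (h x) = G f x by rewrite /y (nth_map f) ?index_mem// nth_index.
  have [hV|hV] := boolP (h x \in Vs).
    rewrite (bigD1_seq (h x))//= big1 ?addr0; last first.
      move=> v vh; rewrite indicE memNset ?mulr0// => hv.
      by rewrite -hv eqxx in vh.
    by rewrite indicE mem_set// mulr1 yE.
  rewrite big_seq big1; last first.
    move=> v vV; rewrite indicE memNset ?mulr0// => hv.
    by move: hV; rewrite hv vV.
  (* On a discarded cell the simple function must be 0, since a nonzero value would make the measure
     of the cell finite. *)
  apply/esym/eqP; rewrite -yE; apply: contraNT hV => y0.
  rewrite mem_filter mem_undup; apply/andP; split.
    by apply/asboolP; exact: sfun_cell_lty ffs Gi y0.
  suff : [set` s] (h x) by [].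
  by rewrite -sE; exists x.
apply: ae_eq_integral => //.
- by apply/measurable_EFinP; apply: measurableT_comp => //; exact: L1_funM.
- apply/measurable_EFinP; apply: measurableT_comp => //.
  by apply: measurable_funB => //; exact: L1_funM.
have := L1_addE f (- g); have := L1_oppE g.
apply: filterS3 gE => x E1 E2 E3 _.
by rewrite -E1 -E2 -E3.
Qed.

End discretization.

Section gamma1_discretization.
Variables (R : realType) (Z : normedModType R).

Lemma zero_in_unit_ball : `|0 : ell2 R| <= 1.
Proof. by rewrite normr0. Qed.

Definition to_unit_ball (x : ell2 R) : unit_ball R :=
  if pselect (`|x| <= 1) is left x1 then exist _ x x1
  else exist _ 0 zero_in_unit_ball.

Lemma to_unit_ballE (x : ell2 R) : `|x| <= 1 -> sval (to_unit_ball x) = x.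
Proof. by move=> x1; rewrite /to_unit_ball; case: pselect. Qed.

(** A factorization [B A] with norm product below [C] is discretized at the vectors [A z], for z in
    [F], and [B] is applied to the atoms. *)
Lemma gamma1_approx (T : Z -> ell2 R) (C : R) : (gamma1 T < C%:E)%E ->
  forall (F : seq Z) (e : R), 0 < e ->
  exists s : seq ({linear Z -> R^o} * unit_ball R),
    (forall z, \sum_(p <- s) `|p.1 z| <= C * `|z|) /\
    (forall z j, z \in F ->
      `|\sum_(p <- s) p.1 z * unit_ball_coord p.2 j - T z j| <= e).
Proof.
move=> /ereal_inf_lt[_ [d [W [nu [A [B [[Ac Bc TBA] ->]]]]]]] ABC F e e0.
set al := fine (opnorm A); set be := fine (opnorm B).
have al0 : 0 <= al by rewrite fine_ge0// opnorm_ge0.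
have be0 : 0 <= be by rewrite fine_ge0// opnorm_ge0.
have alA z : `|A z| <= al * `|z| by exact: opnormP.
have beB f : `|B f| <= be * `|f| by exact: opnormP.
have albe : al * be <= C.
  rewrite -lee_fin EFinM !fineK ?opnorm_fin_num//; exact: ltW.
have be1 : 0 < be + 1 by rewrite ltr_wpDl.
(* [B] multiplies the error by at most [be]; dividing by [be + 1] also covers [be = 0]. *)
have [Vs [c [b [c_lin c_sum b1 approx]]]] :=
  L1_discretize [seq A z | z <- F] (divr_gt0 e0 be1).
have lin v : linear (fun z => be * c v (A z) : R^o).
  by move=> r x y; rewrite linearP c_lin mulrDr mulrCA.
(* The norm of [B] goes into the coefficients, which puts the vectors in the unit ball. If [be = 0],
   then [B] is 0 and the terms vanish. *)
pose s : seq ({linear Z -> R^o} * unit_ball R) :=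
  [seq (linear_pack (lin v), to_unit_ball (be^-1 *: B (b v))) | v <- Vs].
exists s; split=> [z|z j zF].
  rewrite big_map /=; apply: (@le_trans _ _ (be * \sum_(v <- Vs) `|c v (A z)|)).
    rewrite mulr_sumr; apply: ler_sum => v _.
    by rewrite normrM (ger0_norm be0).
  apply: le_trans (ler_wpM2l be0 (c_sum (A z))) _.
  apply: le_trans (ler_wpM2l be0 (alA z)) _.
  by rewrite mulrA [be * al]mulrC ler_wpM2r.
have -> : \sum_(p <- s) p.1 z * unit_ball_coord p.2 j - T z j =
    (B (\sum_(v <- Vs) c v (A z) *: b v - A z)) j.
  rewrite linearB linear_sum TBA.
  change (\sum_(p <- s) p.1 z * unit_ball_coord p.2 j - (B (A z)) j =
   (\sum_(v <- Vs) B (c v (A z) *: b v)) j - (B (A z)) j).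
  congr (_ - _); rewrite l2sum_coord_sum big_map !big_seq.
  apply: eq_bigr => v vV; rewrite /unit_ball_coord /=.
  have Bb : `|B (b v)| <= be by apply: le_trans (beB _) _; rewrite ler_piMr// b1.
  rewrite linearZ to_unit_ballE; last first.
    rewrite normrZ normfV (ger0_norm be0).
    have [->|n0] := eqVneq be 0; first by rewrite invr0 mul0r.
    by rewrite ler_pdivrMl ?mulr1// lt_neqAle eq_sym n0.
  change (be * c v (A z) * (be^-1 * (B (b v)) j) = c v (A z) * (B (b v)) j).
  have [b0|n0] := eqVneq be 0; last first.
    by rewrite mulrACA mulrA mulrAC divff// mul1r mulrC.
  have -> : B (b v) = 0 by apply/eqP; rewrite -normr_le0 -b0.
  by rewrite /= !mulr0.
apply: le_trans (l2sum_coord_le _ j) _; apply: le_trans (beB _) _.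
have := approx (A z) (map_f _ zF); rewrite distrC => h.
apply: le_trans (ler_wpM2l be0 h) _.
rewrite mulrCA ler_piMr ?(ltW e0)// ler_pdivrMr// mul1r lerDl//.
Qed.

End gamma1_discretization.

(** For a finite family and [m] coordinates the truncation to [m] coordinates is used: it agrees
    with [T] there, and [C] does not depend on [m]. *)
Lemma gamma1_trunc_lifting (R : realType) (Z : normedModType R)
    (T : Z -> ell2 R) (C : R) :
  (forall m, (gamma1 (fun z => ell2_trunc m (T z)) < C%:E)%E) ->
  exists (a : nat * (seq int * seq int) -> Z -> R)
    (d : nat * (seq int * seq int) -> ell2 R),
  [/\ forall j b x y, a j (b *: x + y) = b * a j x + a j y,
      forall z s, uniq s -> \sum_(j <- s) `|a j z| * `|d j| <= 6 * C * `|z| &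
      forall z i e, 0 < e -> exists s0 : seq (nat * (seq int * seq int)),
        forall s, uniq s -> {subset s0 <= s} ->
        `|T z i - \sum_(j <- s) a j z * d j i| <= e].
Proof.
move=> hT; apply: ell1_lifting => F m.
have m0 : 0 < m.+1%:R^-1 :> R by rewrite invr_gt0 ltr0n.
have [s [s1 s2]] := gamma1_approx (hT m) F m0.
exists s; split=> // z j zF jm; have := s2 z j zF.
by rewrite ell2_truncE jm.
Qed.

(** * Summing operators on an l_2-sum *)

(** Allows almost extremal choices in each summand: the loss is [e] times the fixed sum of the
    weights. *)
Lemma ler_sum_approx (R : realType) (w a : nat -> R) (N : nat) (b : R) :
  (forall n, 0 <= w n) ->
  (forall e, 0 < e -> \sum_(0 <= n < N) w n * (a n - e) <= b) ->
  \sum_(0 <= n < N) w n * a n <= b.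
Proof.
move=> w0 h; apply/ler_addgt0Pr => e e0.
set M := \sum_(0 <= n < N) w n.
have M0 : 0 <= M by apply: sumr_ge0.
have M1 : 0 < M + 1 by rewrite ltr_wpDl.
have := h _ (divr_gt0 e0 M1).
under eq_bigr do rewrite mulrBr; rewrite sumrB -mulr_suml -/M lerBlDr.
move=> /le_trans; apply; rewrite lerD2l mulrCA ler_piMr ?(ltW e0)//.
by rewrite ler_pdivrMr// mul1r lerDl.
Qed.

Section summing.
Variables (R : realType) (Z : normedModType R).
Implicit Types (s : seq Z) (f : {linear Z -> R^o}).

Lemma weak_l1_norm_ge0 s : (0 <= weak_l1_norm s)%E.
Proof.
have lin0 : linear (fun _ : Z => 0 : R^o).
  by move=> a x y; rewrite scaler0 addr0.
have z0 z : `|linear_pack lin0 z| <= 0 * `|z| by rewrite /= normr0 mul0r.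
apply: ereal_sup_ubound; exists (linear_pack lin0).
  split; first exact: bound_linear_continuous z0.
  by apply: le_trans (opnorm_le (lexx 0) z0) _; rewrite lee_fin.
by congr EFin; rewrite big1// => z _; rewrite normr0.
Qed.

Lemma weak_l1_norm_le s (C : R) :
  (forall f, continuous f -> (opnorm f <= 1)%E -> \sum_(z <- s) `|f z| <= C) ->
  (weak_l1_norm s <= C%:E)%E.
Proof.
by move=> h; apply: ge_ereal_sup => _ [f [fc f1] <-]; rewrite lee_fin h.
Qed.

Lemma weak_l1_normP s f : continuous f -> (opnorm f <= 1)%E ->
  ((\sum_(z <- s) `|f z|)%:E <= weak_l1_norm s)%E.
Proof. by move=> fc f1; apply: ereal_sup_ubound; exists f. Qed.

Lemma weak_l1_norm_fin_num s : weak_l1_norm s \is a fin_num.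
Proof.
rewrite ge0_fin_numE ?weak_l1_norm_ge0//.
apply: le_lt_trans (ltry (\sum_(z <- s) `|z|)); apply: weak_l1_norm_le => f fc f1.
apply: ler_sum => z _; apply: le_trans (opnormP z fc) _.
by rewrite ler_piMl// -lee_fin fineK// opnorm_fin_num.
Qed.

Lemma weak_l1_norm_opnorm s f : continuous f -> (weak_l1_norm s <= 1)%E ->
  \sum_(z <- s) `|f z| <= fine (opnorm f).
Proof.
move=> fc s1; set c := fine (opnorm f).
have fz z : `|f z| <= c * `|z| by exact: opnormP.
have c0 : 0 <= c by rewrite fine_ge0// opnorm_ge0.
have [cE|n0] := eqVneq c 0.
  rewrite cE big1// => z _; apply/eqP; rewrite eq_le normr_ge0 andbT.
  by have := fz z; rewrite cE mul0r.
have cp : 0 < c by rewrite lt_neqAle eq_sym n0.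
have lin : linear (fun z => c^-1 * f z : R^o).
  by move=> a x y; rewrite linearP mulrDr mulrCA.
pose g := linear_pack lin.
have gz z : `|g z| <= 1 * `|z|.
  rewrite /= normrM normfV (gtr0_norm cp) mul1r ler_pdivrMl//; exact: fz.
have := weak_l1_normP s (bound_linear_continuous gz) (opnorm_le ler01 gz).
move=> /le_trans/(_ s1); rewrite lee_fin /=.
under eq_bigr do rewrite normrM normfV (gtr0_norm cp).
by rewrite -mulr_sumr ler_pdivrMl// mulr1.
Qed.

Lemma pi1_ge0 (Y : normedModType R) (T : Z -> Y) : (0 <= pi1 T)%E.
Proof. by apply: le_ereal_inf_tmp => _ [C [C0 _] <-]; rewrite lee_fin. Qed.

(** As [a] is below the infimum, it is not an admissible constant; a family violating it is divided
    by its weak norm. *)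
Lemma pi1_extremal (Y : normedModType R) (T : {linear Z -> Y}) (p a : R) :
  (forall s, ((\sum_(z <- s) `|T z|)%:E <= p%:E * weak_l1_norm s)%E) ->
  (a%:E < pi1 T)%E ->
  exists s, (weak_l1_norm s <= 1)%E /\ a <= \sum_(z <- s) `|T z|.
Proof.
move=> hp aT; have [a0|a0] := ltP a 0.
  exists [::]; split; last by rewrite big_nil ltW.
  by apply: weak_l1_norm_le => f _ _; rewrite big_nil.
have : ~ forall s, ((\sum_(z <- s) `|T z|)%:E <= a%:E * weak_l1_norm s)%E.
  move=> h; move: aT; rewrite ltNge => /negP; apply.
  by apply: ereal_inf_lbound; exists a.
move=> /existsNP[s /negP]; rewrite -ltNge.
rewrite -(fineK (weak_l1_norm_fin_num s)) -EFinM lte_fin.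
set w := fine _ => h.
have w0 : 0 <= w by rewrite fine_ge0// weak_l1_norm_ge0.
(* If the weak norm were 0, the bound with constant [p] would make the sum vanish, against the
   violation. *)
have wp : 0 < w.
  rewrite lt_neqAle w0 andbT; apply/eqP => wE.
  have := hp s; rewrite -(fineK (weak_l1_norm_fin_num s)) -/w -wE -EFinM lee_fin.
  by rewrite mulr0 leNgt; move: h; rewrite -wE mulr0 => ->.
exists [seq w^-1 *: z | z <- s]; split; last first.
  rewrite big_map; under eq_bigr do rewrite linearZ normrZ normfV (gtr0_norm wp).
  by rewrite -mulr_sumr ler_pdivlMl// mulrC ltW.
apply: weak_l1_norm_le => f fc f1; rewrite big_map.
under eq_bigr do rewrite linearZ normrZ normfV (gtr0_norm wp).
rewrite -mulr_sumr ler_pdivrMl// mulr1 -lee_fin fineK ?weak_l1_norm_fin_num//.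
exact: weak_l1_normP.
Qed.

End summing.

Section summing_l2sum.
Variables (R : realType) (X : nat -> completeNormedModType R).
Variables (Y : normedModType R) (T : {linear l2sum X -> Y}) (p : R).
Hypothesis p0 : 0 <= p.
Hypothesis Tp : forall s : seq (l2sum X),
  ((\sum_(z <- s) `|T z|)%:E <= p%:E * weak_l1_norm s)%E.

Lemma l2sum_inj_continuous n : continuous (l2sum_inj X n).
Proof.
by apply: (@bound_linear_continuous _ _ _ _ 1) => z; rewrite mul1r l2sum_inj_norm.
Qed.

Lemma l2sum_comp_inj_continuous (V : normedModType R) (f : l2sum X -> V) n :
  continuous f -> continuous (f \o l2sum_inj X n).
Proof.
move=> fc z; apply: continuous_comp; last exact: fc.
exact: (@l2sum_inj_continuous n z).
Qed.

(** Duality: [f] is tested on the sum of the [|x n| *: y n], where [y n] in the unit ball almost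
    norms the restriction of [f], with the sign that makes the value nonnegative. This vector has
    norm at most [|x|]. *)
Lemma opnorm_inj_sum (f : {linear l2sum X -> R^o}) (x : l2sum X) N :
  continuous f -> (opnorm f <= 1)%E ->
  \sum_(0 <= n < N) `|x n| * fine (opnorm (f \o l2sum_inj X n)) <= `|x|.
Proof.
move=> fc f1; apply: ler_sum_approx => // e e0.
have fcn n : continuous (f \o l2sum_inj X n).
  exact: (l2sum_comp_inj_continuous fc).
have ext n : exists y : X n, `|y| <= 1 /\
    fine (opnorm (f \o l2sum_inj X n)) - e <= f (l2sum_inj X n y).
  have fin : opnorm (f \o l2sum_inj X n) \is a fin_num by exact: (opnorm_fin_num (fcn n)).
  have [_ [y y1 <-]] := ub_ereal_sup_adherent e0 fin.
  move=> hlt; have {}y1 : `|y| <= 1 by [].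
  have h : fine (opnorm (f \o l2sum_inj X n)) - e <= `|f (l2sum_inj X n y)|.
    by rewrite -lee_fin EFinB fineK// ltW.
  have [s0|s0] := leP 0 (f (l2sum_inj X n y)).
    by exists y; split=> //; rewrite -[leRHS]ger0_norm.
  by exists (- y); rewrite normrN; split=> //; rewrite !linearN -(ltr0_norm s0).
pose y n := projT1 (cid (ext n)).
have y1 n : `|y n| <= 1 by rewrite /y; case: cid => ? [].
have ye n : fine (opnorm (f \o l2sum_inj X n)) - e <= f (l2sum_inj X n (y n)).
  by rewrite /y; case: cid => ? [].
pose v := l2sum_cut N (fun n => `|x n| *: y n).
have vx : `|v| <= `|x|.
  apply: l2sum_norm_le_coord => n; rewrite l2sum_cutE; case: ifP => _.
    by rewrite normrZ normr_id ler_piMr// y1.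
  by rewrite normr0.
apply: le_trans vx; apply: (@le_trans _ _ (f v)).
  rewrite /v /l2sum_cut linear_sum; apply: ler_sum => n _.
  by rewrite !linearZ; apply: ler_wpM2l.
apply: le_trans (ler_norm _) _; apply: le_trans (opnormP v fc) _.
by rewrite ler_piMl// -lee_fin fineK// opnorm_fin_num.
Qed.

Lemma pi1_inj_le n (s : seq (X n)) :
  ((\sum_(z <- s) `|(T \o l2sum_inj X n) z|)%:E <= p%:E * weak_l1_norm s)%E.
Proof.
have := Tp [seq l2sum_inj X n z | z <- s]; rewrite big_map.
move=> /le_trans; apply; apply: lee_wpmul2l; first by rewrite lee_fin.
rewrite -(fineK (weak_l1_norm_fin_num s)).
apply: weak_l1_norm_le => f fc f1; rewrite big_map.
rewrite -lee_fin fineK ?weak_l1_norm_fin_num//.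
apply: (@weak_l1_normP _ _ s (f \o l2sum_inj X n)).
  exact: l2sum_comp_inj_continuous.
apply: (opnorm_le ler01) => z; rewrite mul1r.
apply: le_trans (opnormP _ fc) _; apply: le_trans (l2sum_inj_norm z).
by rewrite ler_piMl// -lee_fin fineK// opnorm_fin_num.
Qed.

Lemma pi1_inj_fin_num n : pi1 (T \o l2sum_inj X n) \is a fin_num.
Proof.
rewrite ge0_fin_numE ?pi1_ge0//; apply: le_lt_trans (ltry p).
by apply: ereal_inf_lbound; exists p => //; split=> // s; exact: pi1_inj_le.
Qed.

(** Almost extremal families for the restrictions of [T], scaled by [|x n|], are put together into
    one family. By [opnorm_inj_sum] its weak norm is at most [|x|], so one application of the
    summing bound of [T] controls all the summands. *)
Lemma pi1_inj_sum (x : l2sum X) N :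
  \sum_(0 <= n < N) `|x n| * fine (pi1 (T \o l2sum_inj X n)) <= p * `|x|.
Proof.
apply: ler_sum_approx => // e e0.
have ext n : exists s : seq (X n), (weak_l1_norm s <= 1)%E /\
    fine (pi1 (T \o l2sum_inj X n)) - e <= \sum_(z <- s) `|T (l2sum_inj X n z)|.
  apply: (pi1_extremal (@pi1_inj_le n)).
  by rewrite EFinB fineK ?pi1_inj_fin_num// lteBlDr// lteDl ?pi1_inj_fin_num.
pose s n := projT1 (cid (ext n)).
have s1 n : (weak_l1_norm (s n) <= 1)%E by rewrite /s; case: cid => ? [].
have se n : fine (pi1 (T \o l2sum_inj X n)) - e <=
    \sum_(z <- s n) `|T (l2sum_inj X n z)| by rewrite /s; case: cid => ? [].
pose S := flatten [seq [seq `|x n| *: l2sum_inj X n z | z <- s n] | n <- index_iota 0 N].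
have bigS (g : l2sum X -> R) : \sum_(z <- S) g z =
    \sum_(0 <= n < N) \sum_(z <- s n) g (`|x n| *: l2sum_inj X n z).
  by rewrite big_flatten big_map; apply: eq_bigr => n _; rewrite big_map.
have weakS : (weak_l1_norm S <= `|x|%:E)%E.
  apply: weak_l1_norm_le => f fc f1; apply: le_trans (opnorm_inj_sum x N fc f1).
  rewrite bigS; apply: ler_sum => n _.
  under eq_bigr do rewrite linearZ normrZ normr_id.
  rewrite -mulr_sumr ler_wpM2l//.
  have fcn : continuous (f \o l2sum_inj X n).
    exact: (l2sum_comp_inj_continuous fc).
  exact: (weak_l1_norm_opnorm fcn (s1 n)).
rewrite -lee_fin EFinM; apply: le_trans (le_trans (Tp S) _); last first.
  by rewrite lee_wpmul2l.
rewrite lee_fin bigS; apply: ler_sum => n _.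
under [leRHS]eq_bigr do rewrite linearZ normrZ normr_id.
by rewrite -mulr_sumr ler_wpM2l.
Qed.

End summing_l2sum.

(** * Truncations of finite rank and a uniform constant *)

Section truncated_operator.
Variables (R : realType) (Z : normedModType R) (T : {linear Z -> ell2 R}) (m : nat).

Lemma ell2_trunc_le (y : ell2 R) : `|ell2_trunc m y| <= `|y|.
Proof.
apply: l2sum_norm_le_coord => n; rewrite ell2_truncE; case: ifP => // _.
by rewrite normr0.
Qed.

Lemma trunc_op_linear : linear (fun z => ell2_trunc m (T z)).
Proof.
move=> a x y; apply: l2sum_eqP => i; rewrite linearP.
change (trunc_seq m (a *: T x + T y) i =
  a * trunc_seq m (T x) i + trunc_seq m (T y) i).
by rewrite /trunc_seq; case: ifP => //; rewrite mulr0 addr0.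
Qed.

Definition trunc_op : {linear Z -> ell2 R} := linear_pack trunc_op_linear.

Lemma trunc_op_continuous : continuous T -> continuous trunc_op.
Proof.
move=> /linear_bound[C _ hC]; apply: (@bound_linear_continuous _ _ _ _ C) => z.
exact: le_trans (ell2_trunc_le _) (hC z).
Qed.

Lemma trunc_op_finite_rank : finite_rank trunc_op.
Proof.
exists m, (fun i : 'I_m => ell2_trunc m (fun k => (k == i)%:R)) => z.
exists (fun i : 'I_m => T z i); apply: l2sum_eqP => k.
rewrite l2sum_coord_sum.
change (trunc_seq m (T z) k =
  \sum_(i < m) (T z i * trunc_seq m (fun k => (k == i)%:R) k)).
rewrite /trunc_seq; case: ltnP => km; last by rewrite big1// => i _; rewrite mulr0.
rewrite (bigD1 (Ordinal km))//= eqxx mulr1 big1 ?addr0// => i ik.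
case: eqP => [ki|_]; last by rewrite mulr0.
by case/eqP: ik; apply: val_inj; rewrite /= ki.
Qed.

Lemma pi1_trunc_op : (pi1 trunc_op <= pi1 T)%E.
Proof.
apply: ereal_inf_le_tmp => _ [C [C0 hC] <-]; exists C => //; split=> // s.
apply: le_trans (hC s); rewrite lee_fin; apply: ler_sum => z _.
exact: ell2_trunc_le.
Qed.

End truncated_operator.

(** A real number strictly above the supremum exceeds some admissible constant of every [X n], so it
    is itself admissible for all of them. *)
Lemma gl2_bounded (R : realType) (X : nat -> completeNormedModType R) :
  (ereal_sup (range (fun n => gl2 (X n))) < +oo)%E ->
  exists2 K : R, 0 <= K & forall n (T : {linear X n -> ell2 R}),
    continuous T -> finite_rank T -> (gamma1 T <= K%:E * pi1 T)%E.
Proof.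
set S := ereal_sup _ => Soo.
have [r Sr] : exists r : R, (S < r%:E)%E.
  case: S Soo => [r _|//|_]; last by exists 0; rewrite ltNyr.
  by exists (r + 1); rewrite lte_fin ltrDl.
have h n : exists K : R, [/\ 0 <= K, K <= r & forall T : {linear X n -> ell2 R},
    continuous T -> finite_rank T -> (gamma1 T <= K%:E * pi1 T)%E].
  have : (gl2 (X n) < r%:E)%E.
    by apply: le_lt_trans Sr; apply: ereal_sup_ubound; exists n.
  by move=> /ereal_inf_lt[_ [K [K0 hK] <-]]; rewrite lte_fin => /ltW; exists K.
have [K0 [K00 K0r _]] := h 0%N.
exists r; first exact: le_trans K0r.
move=> n T Tc Tf; have [K [_ Kr hK]] := h n.
apply: le_trans (hK T Tc Tf) _.
by apply: lee_wpmul2r; [exact: pi1_ge0|rewrite lee_fin].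
Qed.

(** * Gluing the factorizations of the summands *)

Lemma sum_fiber (R : realType) (J : eqType) (s : seq (nat * J)) (N : nat)
    (F : nat * J -> R) : (forall i, i \in s -> (i.1 < N)%N) ->
  \sum_(i <- s) F i =
  \sum_(0 <= n < N) \sum_(j <- [seq i.2 | i <- s & i.1 == n]) F (n, j).
Proof.
move=> sN; transitivity (\sum_(i <- s) \sum_(0 <= n < N | i.1 == n) F i).
  rewrite big_seq [RHS]big_seq; apply: eq_bigr => i /sN iN.
  have iN' : i.1 \in index_iota 0 N by rewrite mem_index_iota.
  rewrite big_mkcond (bigD1_seq i.1 iN' (iota_uniq _ _))/= eqxx big1 ?addr0//.
  by move=> n; rewrite eq_sym => /negbTE ->.
rewrite (exchange_big_dep xpredT)//=; apply: eq_bigr => n _.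
rewrite big_map big_filter; apply: eq_bigr => -[n' j] /= /eqP ->.
by [].
Qed.

Lemma fiber_uniq (J : eqType) (s : seq (nat * J)) n :
  uniq s -> uniq [seq i.2 | i <- s & i.1 == n].
Proof.
move=> us; rewrite map_inj_in_uniq ?filter_uniq// => -[n1 j1] [n2 j2].
by rewrite !mem_filter /= => /andP[/eqP -> _] /andP[/eqP -> _] ->.
Qed.

Theorem theorem1p21 (R : realType) (X : nat -> completeNormedModType R)
    (hX : forall n, GL2 (X n))
    (hK : (ereal_sup (range (fun n => gl2 (X n))) < +oo)%E) :
  GL2 (l2sum X).
Proof.
move=> T [Tc /ereal_inf_lt[_ [p [p0 hp] <-] _]].
have [K K0 gK] := gl2_bounded hK.
pose q n := fine (pi1 (T \o l2sum_inj X n)).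
have qE n : (q n)%:E = pi1 (T \o l2sum_inj X n).
  by rewrite /q fineK//; exact: (pi1_inj_fin_num p0 hp).
have q0 n : 0 <= q n by rewrite -lee_fin qE pi1_ge0.
(* The term 2^-n makes the bound on gamma_1 strict, even when [q n = 0], and is summable. *)
pose C n := K * q n + 2 ^- n.
have lifted n := @gamma1_trunc_lifting R (X n) (T \o l2sum_inj X n) (C n).
have {}lifted n : exists ad : (nat * (seq int * seq int) -> X n -> R) *
    (nat * (seq int * seq int) -> ell2 R),
  [/\ forall j b x y, ad.1 j (b *: x + y) = b * ad.1 j x + ad.1 j y,
      forall z s, uniq s -> \sum_(j <- s) `|ad.1 j z| * `|ad.2 j| <= 6 * C n * `|z| &
      forall z i e, 0 < e -> exists s0 : seq (nat * (seq int * seq int)),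
        forall s, uniq s -> {subset s0 <= s} ->
        `|(T \o l2sum_inj X n) z i - \sum_(j <- s) ad.1 j z * ad.2 j i| <= e].
  have [|a [d h]] := lifted n; last by exists (a, d).
  move=> m; pose S := trunc_op (T \o l2sum_inj X n) m.
  have Sc : continuous S.
    by apply: trunc_op_continuous; exact: l2sum_comp_inj_continuous.
  apply: le_lt_trans (gK n S Sc (trunc_op_finite_rank _ _)) _.
  apply: (@le_lt_trans _ _ (K%:E * (q n)%:E)%E).
    by apply: lee_wpmul2l; rewrite ?lee_fin// qE; exact: pi1_trunc_op.
  by rewrite -EFinM lte_fin ltrDl invr_gt0 exprn_gt0.
pose a (i : nat * (nat * (seq int * seq int))) (x : l2sum X) : R :=
  (projT1 (cid (lifted i.1))).1 i.2 (x i.1).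
pose d (i : nat * (nat * (seq int * seq int))) : ell2 R :=
  (projT1 (cid (lifted i.1))).2 i.2.
have a_lin i b x y : a i (b *: x + y) = b * a i x + a i y.
  by rewrite /a; case: cid => ad [h _ _] /=; exact: h.
have C0 n : 0 <= C n.
  by rewrite addr_ge0 ?mulr_ge0// invr_ge0 exprn_ge0.
have a_fiber n x s : uniq s ->
    \sum_(j <- s) `|a (n, j) x| * `|d (n, j)| <= 6 * C n * `|x n|.
  by rewrite /a /d /=; case: cid => ad [_ h _] /=; exact: h.
have bound (s : seq (nat * (nat * (seq int * seq int)))) :
    exists N, forall i, i \in s -> (i.1 < N)%N.
  exists (\sum_(i <- s) i.1.+1)%N => i si.
  by rewrite (big_rem i)//= leq_addr.
(* The summing bound gives [K * p]; the 2 is the sum of the 2^-n, each entry being bounded by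
   [|x|]. *)
have C_sum (x : l2sum X) N : \sum_(0 <= n < N) C n * `|x n| <= (K * p + 2) * `|x|.
  rewrite /C; under eq_bigr do rewrite mulrDl.
  rewrite big_split/= [leRHS]mulrDl; apply: lerD.
    under eq_bigr do rewrite -mulrA [q _ * _]mulrC.
    by rewrite -mulr_sumr -mulrA ler_wpM2l//; exact: (pi1_inj_sum p0 hp).
  apply: (@le_trans _ _ (\sum_(0 <= n < N) 2 ^- n * `|x|)).
    by apply: ler_sum => n _; rewrite ler_wpM2l ?invr_ge0 ?exprn_ge0// l2sum_coord_le.
  rewrite -mulr_suml ler_wpM2r//.
  rewrite -(ler_pM2l (x := 3))// mulr_sumr; apply: le_trans (sum_pow2 R 0 N) _.
  by rewrite expr0 divr1 -natrM.
have a_sum x s : uniq s ->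
    \sum_(i <- s) `|a i x| * `|d i| <= 6 * (K * p + 2) * `|x|.
  move=> us; have [N hN] := bound s; rewrite (sum_fiber _ hN).
  apply: (@le_trans _ _ (\sum_(0 <= n < N) 6 * C n * `|x n|)).
    by apply: ler_sum => n _; apply: a_fiber; exact: fiber_uniq.
  under eq_bigr do rewrite -mulrA.
  by rewrite -mulr_sumr -mulrA ler_wpM2l.
have [A [B [Ac Bc AB]]] := family_factorization a_lin a_sum.
exists _, nat, (nat_counting R), A, B; split=> // x.
(* The convergence criterion is checked on vectors of a single summand; linearity and density extend
   the equality to every [x]. *)
have inj_eq n (z : X n) : B (A (l2sum_inj X n z)) = T (l2sum_inj X n z).
  apply: AB => i e e0.
  have [s0 hs0] : exists s0 : seq (nat * (seq int * seq int)),
      forall s, uniq s -> {subset s0 <= s} ->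
      `|T (l2sum_inj X n z) i - \sum_(j <- s) a (n, j) (l2sum_inj X n z) * d (n, j) i| <= e.
    rewrite /a /d /= inj_seq_id; case: cid => ad [_ _ h] /=; exact: h.
  have a_off k j : k != n -> a (k, j) (l2sum_inj X n z) = 0.
    move=> kn; have := a_lin (k, j) (-1) 0 0.
    rewrite scaler0 addr0 mulN1r addNr => <-.
    by rewrite /a /= inj_seq_neq//; apply/eqP; rewrite eq_sym.
  move: (l2sum_inj X n z) hs0 a_off => y hs0 a_off.
  exists [seq (n, j) | j <- s0] => s us s0s.
  (* Adding [n] to the bound makes sure that the fibre over [n] is among those summed, even if it is
     empty. *)
  have [N hN] := bound s; rewrite (sum_fiber (N := N.+1 + n)); last first.
    by move=> k /hN kN; rewrite ltn_addr// ltnW.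
  have nN : n \in index_iota 0 (N.+1 + n).
    by rewrite mem_index_iota/= addSn ltnS leq_addl.
  rewrite (bigD1_seq n nN (iota_uniq _ _))/=.
  rewrite [X in _ - (_ + X)]big1 ?addr0; last first.
    by move=> k kn; apply: big1 => j _; rewrite a_off// mul0r.
  apply: hs0; first exact: fiber_uniq.
  move=> j js0; apply/mapP; exists (n, j) => //.
  by rewrite mem_filter eqxx/=; apply: s0s; exact: map_f.
have cut_eq N : B (A (l2sum_cut N x)) = T (l2sum_cut N x).
  rewrite /l2sum_cut !linear_sum; apply: eq_bigr => n _; exact: inj_eq.
have cvT : T (l2sum_cut N x) @[N --> \oo] --> T x.
  by apply: continuous_cvg; [exact: Tc|exact: l2sum_cut_cvg].
have cvBA : T (l2sum_cut N x) @[N --> \oo] --> B (A x).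
  under eq_cvg do rewrite -cut_eq.
  apply: continuous_cvg; first exact: Bc.
  by apply: continuous_cvg; [exact: Ac|exact: l2sum_cut_cvg].
exact: (cvg_unique (@norm_hausdorff _ _) cvT cvBA).
Qed.
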